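(* Let $A=(a_1,\dots,a_n)$ be a configuration of points affinely spanning $\mathbb{R}^d$, let $h$ be a generic height function on $A$, and for every $Q\subseteq[n]$ let $\mathcal{T}_Q(h)$ be the weighted Delaunay triangulation of $\mathrm{conv}(\{a_i\}_{i\notin Q})$ (with vertices among $(a_i)_{i\notin Q}$) with height function $h$. Consider the following procedure, in which the link region $\mathcal{R}(I)$ is triangulated by the simplices of $\mathcal{T}_I(h)$ contained in it: (i) Let $\mathcal{I}^{(0)}=\{\varnothing\}$. (ii) For $0\le k\le n-d-1$, let $$\mathcal{P}^{(k)}=\{\Pi_{I,B}:I\in\mathcal{I}^{(k)},\ \Delta_B\in\mathcal{T}_I(h),\ \Delta_B\subseteq\mathcal{R}(I)\},$$ where $\Delta_B:=\mathrm{conv}(\{a_b\}_{b\in B})$ and $\mathcal{R}(I)$ is computed from $\mathcal{P}^{(0)},\dots,\mathcal{P}^{(k-1)}$. (iii) Let $\mathcal{I}^{(k+1)}=\{I\sqcup\{b\}:\Pi_{I,B}\in\mathcal{P}^{(k)},\ b\in B,\ \mathcal{R}(I\sqcup\{b\})\neq\varnothing\}$. (iv) Repeat (ii) and (iii) until $k=n-d-1$. Then this procedure always produces a regular fine zonotopal tiling $\mathcal{P}(h)=\bigsqcup_{k=0}^{n-d-1}\mathcal{P}^{(k)}$ of $Z(V)$.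
   Context: Notation: $[n]=\{1,\dots,n\}$, $|\cdot|$ is cardinality, $\sqcup$ is disjoint union, $d\ge1$. The configuration $A$ is indexed by $[n]$; repeated points and affine dependencies are allowed. Zonotope and tilings: $v_i=(a_i,1)\in\mathbb{R}^{d+1}$, $V=(v_1,\dots,v_n)$, $[0,v_i]=\{\alpha v_i:0\le\alpha\le1\}$, and $Z(V)=\sum_{i=1}^n[0,v_i]$ (Minkowski sum). For disjoint $I,B\subseteq[n]$ with $|B|=d+1$ and $(a_b)_{b\in B}$ affinely independent, the tile is $\Pi_{I,B}=\sum_{i\in I}v_i+\sum_{b\in B}[0,v_b]$. Its faces are $\Pi_{J,C}=\sum_{j\in J}v_j+\sum_{c\in C}[0,v_c]$ with $C\subseteq B$ and $I\subseteq J\subseteq I\sqcup(B\setminus C)$. Tiles and faces are labelled by their index pairs. A fine zonotopal tiling of $Z(V)$ is a collection $\mathcal{P}$ of such tiles forming a polyhedral subdivision of $Z(V)$: the tiles cover $Z(V)$, distinct tiles have disjoint interiors, and any two tiles intersect in a (possibly empty) common face, i.e. one carrying the same label $(J,C)$ in both tiles. Regularity: a zonotopal tiling of $Z(V)$ is regular if its tiles are precisely the projections, forgetting the $(d+1)$-th coordinate, of the faces in the upper convex hull (facets whose outward normal has positive $(d+1)$-th component) of another zonotope $\tilde Z\subset\mathbb{R}^{d+2}$; here $\tilde Z=\sum_i[0,(a_i,\eta_i,1)]$ for some real numbers $\eta_1,\dots,\eta_n$, and labels $(I,B)$ are inherited from the faces. Height functions: a height function assigns a real number $h(a_i)$ to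 each index $i\in[n]$ (repeated points may receive different heights). It is generic if, in the lifted configuration $\tilde A=((a_i,h(a_i)))_{i\in[n]}\subset\mathbb{R}^{d+1}$, the only affinely dependent subsets of $d+2$ points lie on a vertical hyperplane, i.e. one whose normal $N$ satisfies $N_{d+1}=0$. Weighted Delaunay triangulation: for $Q\subseteq[n]$, $\mathcal{T}_Q(h)$ is the triangulation of $\mathrm{conv}(\{a_i\}_{i\notin Q})$ whose simplices $\Delta_B$, labelled by sets $B\subseteq[n]\setminus Q$ with $|B|=d+1$ ordered so that $\det((a_b,1)_{b\in B})>0$, satisfy $$\det\big((a_b,h(a_b),1)_{b\in B},(a_i,h(a_i),1)\big)<0\quad\text{for all } i\in[n]\setminus(Q\cup B).$$ For generic $h$ it exists and is unique (it is empty if the hull has empty interior). Link regions: for $Q\subseteq[n]$ with $|Q|=k$, and $r<k$, $$E^{(r)}(Q)=\bigcup\{\Delta_B:\Pi_{I,B}\in\mathcal{P}^{(r)},\ B\cap Q=\varnothing,\ I\subseteq Q\},\qquad \mathcal{R}(Q)=\mathrm{conv}(\{a_i\}_{i\notin Q})\setminus\bigcup_{r=0}^{k-1}E^{(r)}(Q),$$ where the set difference is understood up to boundary and lower-dimensional parts (i.e. replaced by the closure of its interior), so $\mathcal{R}(Q)\ne\varnothing$ means nonempty interior. *)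

(* Defs.v *)
From HB Require Import structures.
From mathcomp Require Export all_boot all_order all_algebra.
From mathcomp Require Export all_classical all_reals.
From mathcomp Require Export topology normedtype.

Set Implicit Arguments.
Unset Strict Implicit.
Unset Printing Implicit Defensive.

Import Order.TTheory GRing.Theory Num.Theory.
Import numFieldNormedType.Exports.

Local Open Scope classical_set_scope.
Local Open Scope ring_scope.

(* Two set notions occur.  Index sets I, B, Q are finite sets {set 'I_n}
   (delimiter %SET); point sets and collections of labels are classical sets.
   Point configurations are families indexed by 'I_n, so repeated points keep
   distinct indices. *)

Section Configurations.
Variables (R : realType) (m n : nat).
Implicit Types (x : 'I_n -> 'rV[R]_m) (S I B : {set 'I_n}).

Definition dot (u v : 'rV[R]_m) : R := (u *m v^T) 0 0.

Definition affinely_independent x S : Prop :=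
  forall c : 'I_n -> R,
    \sum_(i in S) c i = 0 -> \sum_(i in S) c i *: x i = 0 ->
    forall i, i \in S -> c i = 0.

Definition affinely_spanning x : Prop :=
  forall y : 'rV[R]_m, exists c : 'I_n -> R,
    \sum_i c i = 1 /\ y = \sum_i c i *: x i.

Definition conv x S : set 'rV[R]_m :=
  [set y | exists c : 'I_n -> R,
     [/\ forall i, 0 <= c i,
         \sum_(i in S) c i = 1 &
         y = \sum_(i in S) c i *: x i] ].

(* \sum_(i in I) x_i + \sum_(b in B) [0, x_b] (Minkowski sum) *)
Definition cell x I B : set 'rV[R]_m :=
  [set y | exists c : 'I_n -> R,
     (forall b, 0 <= c b <= 1) /\
     y = \sum_(i in I) x i + \sum_(b in B) c b *: x b].

Definition zonotope x : set 'rV[R]_m := cell x finset.set0 [set: 'I_n]%SET.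

Definition face_of (Z : set 'rV[R]_m) (N : 'rV[R]_m) : set 'rV[R]_m :=
  [set y | Z y /\ forall z, Z z -> dot N z <= dot N y].

End Configurations.

Definition label (n : nat) : Type := ({set 'I_n} * {set 'I_n})%type.

Section Zonotopes.
Variables (R : realType) (d n : nat).
Variable a : 'I_n -> 'rV[R]_d.
Implicit Types (h eta : 'I_n -> R) (I B J C Q : {set 'I_n}).

Definition homog (i : 'I_n) : 'rV[R]_(d + 1) := row_mx (a i) (const_mx 1).

Definition lift_pt h (i : 'I_n) : 'rV[R]_(d + 1) := row_mx (a i) (const_mx (h i)).

Definition lift_homog h (i : 'I_n) : 'rV[R]_(d + 1 + 1) :=
  row_mx (lift_pt h i) (const_mx 1).

Definition tile (L : label n) : set 'rV[R]_(d + 1) := cell homog L.1 L.2.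

Definition is_tile (L : label n) : Prop :=
  [/\ [disjoint L.1 & L.2]%B, #|L.2| = d.+1 & affinely_independent a L.2].

Definition is_face_label (F L : label n) : Prop :=
  [/\ F.2 \subset L.2, L.1 \subset F.1 & F.1 \subset (L.1 :|: (L.2 :\: F.2))%SET].

Definition fine_zonotopal_tiling (P : set (label n)) : Prop :=
  [/\ forall L, P L -> is_tile L,
      \bigcup_(L in P) tile L = zonotope homog,
      forall L L', P L -> P L' -> L <> L' ->
        (tile L)° `&` (tile L')° = set0 &
      forall L L', P L -> P L' ->
        tile L `&` tile L' = set0 \/
        exists F, [/\ is_face_label F L, is_face_label F L' &
                      tile L `&` tile L' = tile F] ].

(* The (d+1)-th of d+2 coordinates is the height coordinate. *)
Definition height_coord (x : 'rV[R]_(d + 1 + 1)) : R := rsubmx (lsubmx x) 0 0.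

Definition forget_height (x : 'rV[R]_(d + 1 + 1)) : 'rV[R]_(d + 1) :=
  row_mx (lsubmx (lsubmx x)) (rsubmx x).

Definition lifted_zonotope eta : set 'rV[R]_(d + 1 + 1) :=
  zonotope (lift_homog eta).

(* A facet is a face of dimension d + 1, i.e. one containing d + 2 affinely
   independent points; it lies in the hyperplane with normal N since N <> 0.
   When n = d + 1 the lifted zonotope is itself of dimension d + 1 and is its
   own upper facet. *)
Definition upper_facet_normal eta (N : 'rV[R]_(d + 1 + 1)) : Prop :=
  0 < height_coord N /\
  exists p : 'I_d.+2 -> 'rV[R]_(d + 1 + 1),
    (forall j, face_of (lifted_zonotope eta) N (p j)) /\
    affinely_independent p [set: 'I_d.+2]%SET.

(* The face of a zonotope maximizing N is the sum of the generators positive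
   on N and of the segments of the generators orthogonal to N. *)
Definition normal_label eta (N : 'rV[R]_(d + 1 + 1)) : label n :=
  ([set i | 0 < dot N (lift_homog eta i)]%SET,
   [set i | dot N (lift_homog eta i) == 0]%SET).

Definition regular_tiling (P : set (label n)) : Prop :=
  exists eta : 'I_n -> R, forall L : label n,
    P L <-> exists N : 'rV[R]_(d + 1 + 1),
      [/\ upper_facet_normal eta N, normal_label eta N = L &
          tile L = forget_height @` face_of (lifted_zonotope eta) N].

Definition generic_height h : Prop :=
  forall S : {set 'I_n}, #|S| = d.+2 -> ~ affinely_independent (lift_pt h) S ->
    exists (N : 'rV[R]_(d + 1)) (c : R),
      [/\ N != 0, rsubmx N 0 0 = 0 & forall s, s \in S -> dot N (lift_pt h s) = c].

(* T_Q(h), as the collection of the vertex index sets B of its simplices; f is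
   the ordering of B.  The determinant inequality says that a_i is lifted
   strictly above the hyperplane through the lifted points of B. *)
Definition weighted_delaunay h Q : set {set 'I_n} :=
  [set B | exists f : 'I_(d + 1) -> 'I_n,
     [/\ injective f, B = [set f j | j : 'I_(d + 1)]%SET, [disjoint B & Q]%B,
         0 < \det (\matrix_j homog (f j)) &
         forall i, i \notin (Q :|: B)%SET ->
           \det (col_mx (\matrix_j lift_homog h (f j)) (lift_homog h i)) < 0] ].

Section Procedure.
Variable h : 'I_n -> R.
(* The history Ps = [:: P^(0); ...; P^(k-1)] of the tiles produced so far. *)
Implicit Type Ps : seq (set (label n)).

Definition covered_region (P : set (label n)) Q : set 'rV[R]_d :=
  \bigcup_(L in [set L | [/\ P L, [disjoint L.2 & Q]%B & L.1 \subset Q]])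
    conv a L.2.

(* The set difference is replaced by the closure of its interior. *)
Definition link_region Ps Q : set 'rV[R]_d :=
  closure (interior (conv a (~: Q)%SET `\`
                       \bigcup_(r < #|Q|) covered_region (nth set0 Ps r) Q)).

Definition next_index_sets Ps : set {set 'I_n} :=
  if size Ps is k.+1 then
    [set J | exists I B b, [/\ nth set0 Ps k (I, B), b \in B,
                               J = (b |: I)%SET & link_region Ps J !=set0] ]
  else [set finset.set0].

Definition next_tiles Ps : set (label n) :=
  [set L | [/\ next_index_sets Ps L.1, weighted_delaunay h L.1 L.2 &
               conv a L.2 `<=` link_region Ps L.1] ].

Fixpoint history (k : nat) : seq (set (label n)) :=
  if k is k'.+1 then rcons (history k') (next_tiles (history k')) else [::].

Definition index_sets (k : nat) : set {set 'I_n} := next_index_sets (history k).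

Definition level_tiles (k : nat) : set (label n) := next_tiles (history k).

Lemma size_history k : size (history k) = k.
Proof. by elim: k => //= k IHk; rewrite size_rcons IHk. Qed.

Lemma nth_history k r : (r < k)%N -> nth set0 (history k) r = level_tiles r.
Proof.
elim: k => //= k IHk; rewrite ltnS leq_eqVlt nth_rcons size_history.
by case/predU1P=> [->|rk]; [rewrite ltnn eqxx | rewrite rk IHk].
Qed.

Lemma index_sets0 : index_sets 0 = [set finset.set0].
Proof. by []. Qed.

Lemma index_setsS k : index_sets k.+1 =
  [set J | exists I B b, [/\ level_tiles k (I, B), b \in B,
             J = (b |: I)%SET & link_region (history k.+1) J !=set0] ].
Proof.
rewrite /index_sets /next_index_sets size_history.
by rewrite (nth_history (ltnSn k)).
Qed.

Lemma level_tilesE k : level_tiles k =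
  [set L | [/\ index_sets k L.1, weighted_delaunay h L.1 L.2 &
               conv a L.2 `<=` link_region (history k) L.1] ].
Proof. by []. Qed.

(* Used only when A spans affinely, so that n >= d + 1 and the truncated
   subtraction n - d - 1 is exact. *)
Definition produced_tiling : set (label n) :=
  \bigcup_(k in [set k | (k <= n - d - 1)%N]) level_tiles k.

End Procedure.
End Zonotopes.

(* Main.v *)
(* An affine function g on R^d is encoded by a column vector, with value
   [value a g i] at a_i.  The hyperplanes {g | g(a_i) = h_i} form an arrangement
   in the space of affine functions; by genericity it is simple at every vertex
   g, in the sense that the zero set B = {i | g(a_i) = h_i} indexes an affine
   basis.  Put I = {i | g(a_i) > h_i}.  The labels (I, B) of the vertices are
   exactly the tiles of the procedure, and the facets of the upper hull of the
   zonotope lifted by eta = - h.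

   Procedure: T_Q(h) consists of the B coming from vertices with B disjoint from
   Q and I \subset Q.  Distinct simplices of T_Q(h) have disjoint interiors, so by
   induction on the level Delta_B lies in R(Q) iff I = Q.  That every such I does
   belong to the index sets follows from a simplex-method walk from the
   vertex (I, B): decreasing g(a_i) for some i in I must cross a
   hyperplane indexed by I.

   Tiling: the affine functions are the dual variables of the linear program
   minimising \sum c_i h_i over the coefficients 0 <= c_i <= 1 of a given point
   y of Z(V).  A dual optimal vertex gives a tile containing y, and complementary
   slackness makes the tiles meet face to face. *)
Require Import Defs.
From mathcomp Require Import perm lra.

Set Implicit Arguments.
Unset Strict Implicit.
Unset Printing Implicit Defensive.

Import Order.TTheory GRing.Theory Num.Theory.
Import numFieldNormedType.Exports.

Local Open Scope classical_set_scope.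
Local Open Scope ring_scope.

(** * Affine bases, and affine functions determined by their values on them *)

Section AffineBases.
Variables (R : realType) (d n : nat) (a : 'I_n -> 'rV[R]_d).
Implicit Types (B S : {set 'I_n}) (g u : 'cV[R]_(d + 1)).

Definition value u (i : 'I_n) : R := (homog a i *m u) 0 0.

Lemma valueD u g i : value (u + g) i = value u i + value g i.
Proof. by rewrite /value mulmxDr mxE. Qed.

Lemma valueZ t u i : value (t *: u) i = t * value u i.
Proof. by rewrite /value -scalemxAr mxE. Qed.

Lemma value_comb (I : Type) (r : seq I) (P : pred I) (c : I -> R) (F : I -> 'I_n) u :
  ((\sum_(i <- r | P i) c i *: homog a (F i)) *m u) 0 0 =
  \sum_(i <- r | P i) c i * value u (F i).
Proof.
rewrite mulmx_suml summxE; apply: eq_bigr => i _.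
by rewrite -scalemxAl [LHS]mxE.
Qed.

Definition is_basis B : Prop := #|B| = d.+1 /\ affinely_independent a B.

Lemma homog_comb S (c : 'I_n -> R) : \sum_(i in S) c i *: homog a i =
  row_mx (\sum_(i in S) c i *: a i) (const_mx (\sum_(i in S) c i)).
Proof.
rewrite -[LHS]hsubmxK !linear_sum /=; congr row_mx.
  by apply: eq_bigr => i _; rewrite linearZ /= row_mxKl.
apply/rowP => j; rewrite summxE mxE.
by apply: eq_bigr => i _; rewrite linearZ /= row_mxKr !mxE mulr1.
Qed.

Lemma affinely_independentP S : affinely_independent a S <->
  (forall c : 'I_n -> R, \sum_(i in S) c i *: homog a i = 0 ->
     forall i, i \in S -> c i = 0).
Proof.
split=> indep c; last first.
  by move=> c0 ca0; apply: indep; rewrite homog_comb c0 ca0; exact: row_mx0.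
rewrite homog_comb -[RHS]row_mx0 => /eq_row_mx[ca0 /rowP/(_ 0)].
by rewrite !mxE => c0; apply: indep.
Qed.

Lemma basis_frame B : is_basis B -> exists f : 'I_(d + 1) -> 'I_n,
  [/\ injective f, B = [set f j | j : 'I_(d + 1)]%SET &
      (\matrix_j homog a (f j)) \in unitmx].
Proof.
case=> cardB /affinely_independentP indep.
have e : (d + 1 = #|B|)%N by rewrite cardB addn1.
pose f j := enum_val (cast_ord e j).
have f_inj : injective f by move=> i j /enum_val_inj/cast_ord_inj.
have fB : B = [set f j | j : 'I_(d + 1)]%SET.
  apply/setP => i; apply/idP/imsetP => [iB|[j _ ->]]; last exact: enum_valP.
  exists (cast_ord (esym e) (enum_rank_in iB i)) => //.
  by rewrite /f cast_ordKV enum_rankK_in.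
exists f; split=> //.
rewrite -row_free_unit; apply: contraT; rewrite -kermx_eq0 => /rowV0Pn[x /sub_kermxP xM /eqP[]].
pose c i := if [pick j | f j == i] is Some j then x 0 j else 0.
have cf j : c (f j) = x 0 j.
  by rewrite /c; case: pickP => [k /eqP/f_inj->|/(_ j)] //; rewrite eqxx.
apply/rowP => j; rewrite mxE -cf; apply: indep; last by rewrite fB imset_f.
rewrite fB big_imset /=; last by move=> ? ? _ _ /f_inj.
rewrite -[RHS]xM mulmx_sum_row; apply: eq_bigr => k _.
by rewrite cf rowK.
Qed.

Lemma frame_basis (f : 'I_(d + 1) -> 'I_n) : injective f ->
  (\matrix_j homog a (f j)) \in unitmx -> is_basis [set f j | j : 'I_(d + 1)]%SET.
Proof.
move=> f_inj fU; split; first by rewrite card_imset // card_ord addn1.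
apply/affinely_independentP => c; rewrite big_imset /=; last by move=> ? ? _ _ /f_inj.
move=> c0 _ /imsetP[j _ ->].
have : (\row_j c (f j)) *m (\matrix_j homog a (f j)) = 0.
  by rewrite -[RHS]c0 mulmx_sum_row; apply: eq_bigr => k _; rewrite rowK mxE.
by move/(canRL (mulmxK fU)); rewrite mul0mx => /rowP/(_ j); rewrite !mxE.
Qed.

Lemma basis_interpolation B (w : 'I_n -> R) : is_basis B ->
  exists g, forall b, b \in B -> value g b = w b.
Proof.
case/basis_frame => f [f_inj -> fU].
exists (invmx (\matrix_j homog a (f j)) *m \col_j w (f j)) => _ /imsetP[j _ ->].
rewrite /value -(rowK (fun j => homog a (f j))) mulmxA -row_mul mulmxV //.
by rewrite -row_mul mul1mx !mxE.
Qed.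

Lemma basis_span B (y : 'rV[R]_(d + 1)) : is_basis B ->
  exists c : 'I_n -> R, y = \sum_(b in B) c b *: homog a b.
Proof.
case/basis_frame => f [f_inj -> fU].
pose x := y *m invmx (\matrix_j homog a (f j)).
pose c i := if [pick j | f j == i] is Some j then x 0 j else 0.
exists c; rewrite big_imset /=; last by move=> ? ? _ _ /f_inj.
rewrite -[LHS](mulmxKV fU) -/x mulmx_sum_row; apply: eq_bigr => j _; rewrite rowK /c.
by case: pickP => [k /eqP/f_inj->|/(_ j)] //; rewrite eqxx.
Qed.

Lemma basis_coords_eq B (c c' : 'I_n -> R) : is_basis B ->
  \sum_(b in B) c b *: homog a b = \sum_(b in B) c' b *: homog a b ->
  forall b, b \in B -> c b = c' b.
Proof.
case=> _ /affinely_independentP indep /eqP; rewrite -subr_eq0 -sumrB => /eqP cc b bB.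
apply/eqP; rewrite -subr_eq0; apply/eqP; apply: (indep (fun b => c b - c' b)) => //.
by rewrite -[RHS]cc; apply: eq_bigr => i _; rewrite scalerBl.
Qed.

Lemma value_span B u g : is_basis B -> {in B, value u =1 value g} -> u = g.
Proof.
move=> basB eqB; apply/colP => k.
have [c ek] := basis_span (delta_mx 0 k) basB.
have valk (v : 'cV[R]_(d + 1)) : v k 0 = \sum_(b in B) c b * value v b.
  by rewrite -value_comb -ek -rowE mxE.
by rewrite !valk; apply: eq_bigr => b bB; rewrite eqB.
Qed.

(** Applying [u] to a linear relation among the new homogenised points leaves only the term at [i].
    Its coefficient therefore vanishes, and what remains is a relation inside [B]. *)
Lemma basis_exchange B u j i : is_basis B -> j \in B -> i \notin B ->
  (forall b, b \in B -> b != j -> value u b = 0) -> value u i != 0 ->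
  is_basis (i |: B :\ j)%SET.
Proof.
move=> basB jB iB u0 ui; have [cardB indep] := basB.
have iBj : i \notin (B :\ j)%SET by rewrite !inE negb_and iB orbT.
split; first by move: cardB; rewrite cardsU1 iBj (cardsD1 j B) jB.
apply/affinely_independentP => c; rewrite big_setU1 //= => c0.
have ci0 : c i = 0.
  have := congr1 (fun x => (x *m u) 0 0) c0.
  rewrite /= mulmxDl mxE -scalemxAl mxE -/(value u i) value_comb mul0mx mxE.
  rewrite big1 ?addr0 => [/eqP|b]; first by rewrite mulf_eq0 (negPf ui) orbF => /eqP.
  by rewrite !inE => /andP[bj bB]; rewrite u0 ?mulr0.
move=> b; rewrite !inE => /predU1P[-> //|/andP[bj bB]].
move/affinely_independentP: indep => /(_ (fun b => if b == j then 0 else c b)) /(_ _ b bB).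
rewrite (negPf bj); apply; rewrite (big_setD1 j) //= eqxx scale0r add0r.
move: c0; rewrite ci0 scale0r add0r => {2}<-.
by apply: eq_bigr => k; rewrite !inE => /andP[/negPf->].
Qed.

(** The rows [homog a i], replaced by zero outside [S], form a matrix of full column rank, since a
    kernel column is an affine function vanishing on [S]. An invertible selection of rows contains
    no zero row, hence is indexed inside [S]. *)
Lemma exists_basis S :
  (forall g, (forall i, i \in S -> value g i = 0) -> g = 0) ->
  exists2 B : {set 'I_n}, B \subset S & is_basis B.
Proof.
move=> S0.
pose M : 'M[R]_(n, d + 1) := \matrix_i if i \in S then homog a i else 0.
have Mfull : row_full M.
  rewrite /row_full -mxrank_tr -/(row_free _).
  apply: contraT; rewrite -kermx_eq0 => /rowV0Pn[x /sub_kermxP xM /eqP[]].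
  rewrite -[x]trmxK [x^T]S0 ?trmx0 // => i iS.
  have /(congr1 (fun v : 'cV_n => v i 0)) : M *m x^T = 0.
    by rewrite -[M]trmxK -trmx_mul xM trmx0.
  rewrite [X in _ = X]mxE => xMi; rewrite -[RHS]xMi /value !mxE.
  by apply: eq_bigr => k _; rewrite [M _ _]mxE iS.
pose f := fullrankfun Mfull.
have fU : rowsub f M \in unitmx by rewrite -row_full_unit; exact: fullrowsub_full.
have fS j : f j \in S.
  apply: contraT => fjS.
  have := congr1 (fun A => row j A 0 j) (mulmxV fU).
  rewrite /= row_mul (_ : row j _ = 0) ?mul0mx; last first.
    by apply/rowP => k; rewrite !mxE (negPf fjS) mxE.
  by rewrite !mxE eqxx => /esym/eqP; rewrite oner_eq0.
exists [set f j | j : 'I_(d + 1)]%SET; first by apply/fintype.subsetP => _ /imsetP[j _ ->].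
apply: frame_basis; first exact: fullrankfun_inj.
by congr (_ \in unitmx): fU; apply/row_matrixP => j; rewrite !rowK row_rowsub rowK fS.
Qed.

End AffineBases.

Lemma disjoint_gt0_eq0 (R : realType) (n : nat) (f : 'I_n -> R) :
  [disjoint [set i | 0 < f i]%SET & [set i | f i == 0]%SET]%B.
Proof.
rewrite -finset.setI_eq0; apply/eqP/setP => i; rewrite !inE andbC.
by apply/negP => /andP[/eqP->]; rewrite ltxx.
Qed.

(** * Vertices of the hyperplane arrangement and simplex steps between them *)

Section Vertices.
Variables (R : realType) (d n : nat) (a : 'I_n -> 'rV[R]_d) (h : 'I_n -> R).
Implicit Types (B S Q : {set 'I_n}) (g u : 'cV[R]_(d + 1)).

Definition gap g i : R := value a g i - h i.

Definition zeros g : {set 'I_n} := [set i | gap g i == 0]%SET.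

Definition positives g : {set 'I_n} := [set i | 0 < gap g i]%SET.

Definition vertex g : Prop := is_basis a (zeros g).

Lemma gapD g t u i : gap (g + t *: u) i = gap g i + t * value a u i.
Proof. by rewrite /gap valueD valueZ addrAC. Qed.

Lemma disjoint_positives_zeros g : [disjoint positives g & zeros g]%B.
Proof. exact: disjoint_gt0_eq0. Qed.

Lemma lift_pt_comb S (c : 'I_n -> R) : \sum_(i in S) c i *: lift_pt a h i =
  row_mx (\sum_(i in S) c i *: a i) (const_mx (\sum_(i in S) c i * h i)).
Proof.
rewrite -[LHS]hsubmxK !linear_sum /=; congr row_mx.
  by apply: eq_bigr => i _; rewrite linearZ /= row_mxKl.
apply/rowP => j; rewrite summxE mxE.
by apply: eq_bigr => i _; rewrite linearZ /= row_mxKr !mxE.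
Qed.

Hypothesis h_generic : generic_height a h.

(** A further zero [i] would put d + 2 lifted points on the graph of [g], making them affinely
    dependent. Genericity places them on a vertical hyperplane, which projects to a hyperplane
    containing all points of the basis [B]: a contradiction. *)
Lemma generic_zeros B g : is_basis a B -> {in B, forall b, gap g b = 0} -> zeros g = B.
Proof.
move=> basB gB; apply/setP => i; rewrite inE; apply/idP/idP => [gi|/gB->//].
apply: contraT => iB; have [cardB _] := basB.
have [c ci] := basis_span (homog a i) basB.
have valB b : b \in (i |: B)%SET -> value a g b = h b.
  rewrite !inE => /predU1P[->|/gB/eqP]; last by rewrite subr_eq0 => /eqP.
  by move: gi; rewrite subr_eq0 => /eqP.
have [||N [w [N0 Nh Nw]]] := h_generic (S := (i |: B)%SET).
- by rewrite cardsU1 iB cardB.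
(* The coefficients of [a i] in [B], with -1 at [i], form a dependency of the points; it lifts
   because every height is a value of [g]. *)
- pose c' k := if k == i then -1 else c k.
  have c'B (V : lmodType R) (F : 'I_n -> V) :
      \sum_(k in B) c' k *: F k = \sum_(k in B) c k *: F k.
    apply: eq_bigr => k kB; rewrite /c'; case: eqP => // ki.
    by rewrite -ki kB in iB.
  have := homog_comb a (i |: B)%SET c'.
  rewrite big_setU1 //= c'B {1}/c' eqxx scaleN1r -ci addNr => /esym e0.
  have /eq_row_mx[c'a /rowP/(_ 0)] := etrans e0 (esym (row_mx0 _ _ _ _)).
  rewrite !mxE => c'1 /(_ c' c'1).
  rewrite lift_pt_comb c'a.
  have -> : \sum_(k in (i |: B)%SET) c' k * h k = 0.
    rewrite (eq_bigr (fun k => c' k * value a g k)); last by move=> k /valB->.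
    by rewrite -(value_comb a _ _ c' id g) homog_comb c'a c'1 row_mx0 mul0mx mxE.
  move=> /(_ (row_mx0 _ _ _ _) i); rewrite !inE eqxx => /(_ isT).
  by rewrite /c' eqxx => /eqP; rewrite oppr_eq0 oner_eq0.
(* [l] is the affine function defining the projected hyperplane; vanishing on a basis, it is zero,
   and so is [N]. *)
pose l : 'cV[R]_(d + 1) := col_mx (lsubmx N)^T (const_mx (- w)).
have Nr0 : rsubmx N = 0 by apply/rowP => k; rewrite ord1 Nh mxE.
have l0 : l = 0.
  apply: (value_span basB) => b bB; rewrite {2}/value mulmx0 mxE.
  have bB' : b \in (i |: B)%SET by rewrite !inE bB orbT.
  have := Nw b bB'; rewrite /dot -{1}(hsubmxK N) Nr0 tr_row_mx mul_row_col.
  rewrite mul0mx addr0 mxE => Na.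
  rewrite /value /l /homog mul_row_col mxE [X in _ + X]mxE big_ord1 !mxE mul1r.
  rewrite -Na; apply/eqP; rewrite subr_eq0; apply/eqP.
  by apply: eq_bigr => k _; rewrite !mxE mulrC.
case/eqP: N0; rewrite -(hsubmxK N) -[RHS]row_mx0; congr row_mx => //.
  have /eq_col_mx[Nl0 _] : l = col_mx 0 0 by rewrite l0 col_mx0.
  by rewrite -[lsubmx N]trmxK Nl0 trmx0.
Qed.

Lemma vertex_of_basis B : is_basis a B -> exists2 g, zeros g = B & vertex g.
Proof.
move=> basB; have [g gB] := basis_interpolation h basB.
have e : zeros g = B by apply: generic_zeros => // b /gB; rewrite /gap => ->; rewrite subrr.
by exists g; rewrite // /vertex e.
Qed.

Lemma vertex_eq g g' : vertex g -> zeros g = zeros g' -> g = g'.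
Proof.
move=> vg e; apply: (value_span vg) => b bg.
have := bg; rewrite e; move: bg; rewrite !inE !subr_eq0 => /eqP-> /eqP->.
by [].
Qed.

(* Simplex step: leave the vertex g along the edge that relaxes j, up to the
   first hyperplane hit. *)
Lemma pivot g u j i0 : vertex g -> j \in zeros g ->
  (forall b, b \in zeros g -> b != j -> value a u b = 0) -> value a u j != 0 ->
  gap g i0 * value a u i0 < 0 ->
  exists t i, [/\ 0 < t, i \notin zeros g,
    zeros (g + t *: u) = (i |: zeros g :\ j)%SET, vertex (g + t *: u) &
    forall k, k \notin zeros g -> k != i ->
      (0 < gap (g + t *: u) k) = (0 < gap g k)].
Proof.
move=> vg jg u0 uj i0P.
(* Ratio test: [T i] is the time at which the gap at [i] vanishes along the edge, and [P i] says
   that this time is positive. *)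
pose T i := - gap g i / value a u i.
pose P i := gap g i * value a u i < 0.
have := Order.TotalTheory.arg_minP T (i0P : P i0).
case=> i Pi minT; move: minT; set t := T i => minT.
have gi : gap g i != 0 by apply: contraL Pi => /eqP; rewrite /P => ->; rewrite mul0r ltxx.
have ui : value a u i != 0 by apply: contraL Pi => /eqP; rewrite /P => ->; rewrite mulr0 ltxx.
have t0 : 0 < t.
  rewrite /t /T mulNr oppr_gt0 -(pmulr_llt0 _ (_ : 0 < value a u i ^+ 2)).
    by rewrite expr2 mulrA mulfVK.
  by rewrite exprn_even_gt0.
have ig : i \notin zeros g by rewrite inE.
have bas : is_basis a (i |: zeros g :\ j)%SET by apply: (basis_exchange (u := u)).
have z' : zeros (g + t *: u) = (i |: zeros g :\ j)%SET.
  apply: generic_zeros => // b; rewrite !inE gapD => /predU1P[->|/andP[bj /eqP gb]].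
    by rewrite /t /T divfK // subrr.
  by rewrite gb u0 ?mulr0 ?addr0 // inE gb.
exists t, i; split=> //; first by rewrite /vertex z'.
move=> k kg ki.
have : gap (g + t *: u) k != 0.
  have : k \notin zeros (g + t *: u) by rewrite z' in_setU1 in_setD1 negb_or ki negb_and kg orbT.
  by rewrite inE.
have := minT k; rewrite /P /T gapD.
move: kg; rewrite inE; move: (gap g k) (value a u k) => x y x0 Tk xy0.
(* The minimality of [t] with denominators cleared by [y ^+ 2], in polynomial form for [nra]. *)
have {}Tk : x * y < 0 -> t * y ^+ 2 <= - x * y.
  move=> xy; have y0 : y != 0 by apply: contraL xy => /eqP->; rewrite mulr0 ltxx.
  rewrite -ler_pdivlMr ?exprn_even_gt0 // expr2 invfM mulrA mulfK //.
  exact: Tk.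
case: (ltgtP x 0) x0 => // x0 _; [apply/negbTE; rewrite -leNgt le_eqVlt|rewrite lt_def].
- rewrite (negPf xy0) /= ltNge; apply/negP => le0.
  have y0 : 0 < y by have [|//] := leP y 0; nra.
  have := Tk _; nra.
- rewrite xy0 /= leNgt; apply/negP => lt0.
  have y0 : y < 0 by have [|//] := leP 0 y; nra.
  have := Tk _; nra.
Qed.


(** A vertex is determined by its zero set, so there are finitely many vertices and any function
    attains a minimum on those satisfying [Pr]. *)
Lemma min_vertex (Pr : 'cV[R]_(d + 1) -> Prop) (phi : 'cV[R]_(d + 1) -> R) g0 :
  vertex g0 -> Pr g0 ->
  exists g, [/\ vertex g, Pr g & forall g', vertex g' -> Pr g' -> phi g <= phi g'].
Proof.
move=> vg0 Prg0.
(* The default 0 is harmless, because [P] below tests [F B] itself. *)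
pose F B : 'cV[R]_(d + 1) := xget 0 [set g | vertex g /\ zeros g = B].
have FP g : vertex g -> F (zeros g) = g.
  move=> vg; rewrite /F; case: xgetP => [g' _ [vg' e]|/(_ g) []] //.
  exact: vertex_eq.
pose P B := `[< vertex (F B) /\ Pr (F B) >].
have P0 : P (zeros g0) by apply/asboolP; rewrite FP.
case: (Order.TotalTheory.arg_minP (phi \o F) P0) => B /asboolP[vB PB] minB.
exists (F B); split=> // g' vg' Pg'.
by have := minB (zeros g'); rewrite /P /= FP //; apply; apply/asboolP.
Qed.

Lemma value_comb1 S (c : 'I_n -> R) i :
  homog a i = \sum_(k in S) c k *: homog a k -> \sum_(k in S) c k = 1.
Proof. by rewrite homog_comb => /eq_row_mx[_ /rowP/(_ 0)]; rewrite !mxE. Qed.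

(* Minimising g at a_i0 over the vertices g with the same positive set forces
   the last simplex step to cross a hyperplane indexed by the positive set. *)
Lemma lower_neighbour g i0 : vertex g -> i0 \in positives g ->
  exists g' j, [/\ vertex g', j \in zeros g' & positives g = (j |: positives g')%SET].
Proof.
move=> vg0 i0g0.
have [{vg0}g1 [vg eqg ming]] := min_vertex
  (Pr := fun g' => positives g' = positives g) (fun g' => value a g' i0) vg0 erefl.
rewrite -eqg in i0g0 *; move: i0g0 ming; rewrite -{}eqg => {g} i0g ming.
move: g1 => g in vg i0g ming *.
have [c ci0] := basis_span (homog a i0) vg.
have c1 := value_comb1 ci0.
(* The coordinates of [a i0] sum to 1, so one of them is positive; relaxing that [j] downwards
   decreases the value at [a i0]. *)
have [j jg cj0] : exists2 j, j \in zeros g & 0 < c j.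
  apply/exists_inP; apply: contraT => /exists_inPn c0.
  have : \sum_(k in zeros g) c k <= 0 by apply: sumr_le0 => k /c0; rewrite -leNgt.
  by rewrite c1 ler10.
have [u uB] := basis_interpolation (fun k => if k == j then -1 else 0 : R) vg.
have uj : value a u j = -1 by rewrite uB // eqxx.
have u0 b : b \in zeros g -> b != j -> value a u b = 0.
  by move=> bg /negPf bj; rewrite uB ?bj.
have ui0 : value a u i0 = - c j.
  rewrite [LHS]/value ci0 (value_comb a _ _ c id u) (big_setD1 j) //= uj mulrN1.
  by rewrite big1 ?addr0 // => b; rewrite !inE => /andP[bj bg]; rewrite u0 ?mulr0 ?inE.
have gi0 : 0 < gap g i0 by rewrite inE in i0g.
have [||t [i [t0 ig zg' vg' sg']]] := pivot (u := u) (j := j) (i0 := i0) vg jg u0.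
- by rewrite uj oppr_eq0 oner_eq0.
- by rewrite ui0 mulrN oppr_lt0 mulr_gt0.
(* The relaxed [j] becomes negative and the hyperplane hit, [i], becomes a zero; no other index
   enters or leaves the positive set. *)
have pg' : positives (g + t *: u) = (positives g :\ i)%SET.
  apply/setP => k; rewrite in_setD1 ![k \in positives _]inE.
  have [->|ki] := eqVneq k i.
    have : i \in zeros (g + t *: u) by rewrite zg' !inE eqxx.
    by rewrite inE => /eqP->; rewrite ltxx.
  have [kg|kg] /= := boolP (k \in zeros g); last exact: sg'.
  have [->|kj] := eqVneq k j.
    rewrite gapD uj; move: jg; rewrite inE => /eqP->; rewrite ltxx add0r mulrN1.
    by rewrite oppr_gt0 ltNge ltW.
  have : k \in zeros (g + t *: u) by rewrite zg' in_setU1 in_setD1 kj kg orbT.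
  by rewrite inE => /eqP->; move: kg; rewrite inE => /eqP->; rewrite ltxx.
exists (g + t *: u), i; split=> //; first by rewrite zg' !inE eqxx.
(* If [i] were not positive, the positive set would be unchanged while the value at [a i0] dropped,
   against minimality. *)
have [iP|iP] := boolP (i \in positives g); first by rewrite pg' finset.setD1K.
have /(ming _ vg') : positives (g + t *: u) = positives g.
  by rewrite pg'; apply/finset.setDidPl; rewrite disjoint_sym disjoints1.
by rewrite valueD valueZ ui0 lerDl mulrN oppr_ge0 leNgt mulr_gt0.
Qed.

(** * Weighted Delaunay simplices as vertices, through determinants *)

Lemma xcol_row_mx (x : 'rV[R]_d) (p q : 'rV[R]_1) :
  row_mx (row_mx x p) q =
  xcol (lshift 1 (rshift d ord0)) (rshift (d + 1) ord0) (row_mx (row_mx x q) p).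
Proof.
apply/rowP => k; rewrite [RHS]mxE.
case: tpermP => [->|->|]; rewrite ?(row_mxEl, row_mxEr) //.
rewrite -(splitK k); case: (fintype.split k) => /= {}k; last first.
  by rewrite [k]ord1.
rewrite !row_mxEl -(splitK k); case: (fintype.split k) => /= {}k; last first.
  by rewrite [k]ord1.
by rewrite !row_mxEl.
Qed.

(** Swapping the last two columns brings the heights to the end; subtracting from them the values of
    [g] clears the rows of the simplex and leaves [- gap g i] in the last row. This sign and the
    sign of the swap cancel. *)
Lemma det_lift_homog g (f : 'I_(d + 1) -> 'I_n) i : (forall j, gap g (f j) = 0) ->
  \det (col_mx (\matrix_j lift_homog a h (f j)) (lift_homog a h i)) =
  \det (\matrix_j homog a (f j)) * gap g i.
Proof.
move=> gf.
pose H := \matrix_j homog a (f j).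
pose M := block_mx H (\col_j h (f j)) (homog a i) (const_mx (h i)).
have -> : col_mx (\matrix_j lift_homog a h (f j)) (lift_homog a h i) =
    xcol (lshift 1 (rshift d ord0)) (rshift (d + 1) ord0) M.
  apply/row_matrixP => k; rewrite -(splitK k).
  case: (fintype.split k) => /= {}k.
    rewrite rowKu rowK xcolE row_mul -xcolE /M /block_mx rowKu row_row_mx rowK.
    rewrite [lift_homog _ _ _]xcol_row_mx; congr (xcol _ _ (row_mx _ _)).
    by apply/rowP => l; rewrite !mxE.
  rewrite rowKd xcolE row_mul -xcolE /M /block_mx rowKd [k]ord1 !row_id.
  exact: xcol_row_mx.
rewrite xcolE det_mulmx det_perm odd_tperm /=.
have MU : M *m block_mx 1%:M (- g) 0 1%:M = block_mx H 0 (homog a i) (const_mx (- gap g i)).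
  rewrite mulmx_block !mulmx1 !mulmx0 !addr0; congr block_mx.
    have -> : H *m - g = - \col_j value a g (f j).
      rewrite mulmxN; congr (- _); apply/colP => j; rewrite mxE [RHS]mxE [RHS]mxE.
      by apply: eq_bigr => k _; rewrite [H _ _]mxE.
    apply/colP => j; rewrite 5!mxE addrC -opprB -/(gap g (f j)) gf.
    by rewrite oppr0.
  have -> : homog a i *m - g = - const_mx (value a g i).
    by rewrite mulmxN; congr (- _); apply/matrixP => k l; rewrite !ord1 [RHS]mxE.
  by apply/matrixP => k l; rewrite !mxE opprB addrC.
have := congr1 determinant MU; rewrite det_mulmx det_ublock !det1 !mulr1 det_lblock => ->.
by rewrite det_mx11 mxE eq_lrshift expr1 mulrN1 mulrN opprK.
Qed.

(** For a positively oriented frame the determinant has the sign of the gap, so the inequalities say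
    that no index outside [Q] is positive; genericity accounts for their strictness. *)
Lemma weighted_delaunayP Q B : (1 <= d)%N -> weighted_delaunay a h Q B <->
  exists g, [/\ vertex g, zeros g = B, [disjoint B & Q]%B & positives g \subset Q].
Proof.
move=> d1; split=> [[f [f_inj -> dis detH above]]|[g [vg <- dis pos]]].
  have bas : is_basis a [set f j | j : 'I_(d + 1)]%SET.
    by apply: frame_basis; rewrite // unitmxE unitfE gt_eqF.
  have [g zg vg] := vertex_of_basis bas; exists g; split=> //.
  apply/fintype.subsetP => i ig; apply: contraT => iQ.
  have /above : i \notin (Q :|: [set f j | j : 'I_(d + 1)])%SET.
    rewrite finset.in_setU negb_or iQ -zg.
    by rewrite (disjointFr (disjoint_positives_zeros g) ig).
  rewrite (det_lift_homog (g := g)) => [|j].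
    by rewrite pmulr_rlt0 // ltNge ltW //; rewrite inE in ig.
  have : f j \in zeros g by rewrite zg imset_f.
  by rewrite inE => /eqP.
suff [f [f_inj zg detH]] : exists f : 'I_(d + 1) -> 'I_n, [/\ injective f,
    zeros g = [set f j | j : 'I_(d + 1)]%SET & 0 < \det (\matrix_j homog a (f j))].
  exists f; split=> // i; rewrite finset.in_setU negb_or => /andP[iQ ig].
  have gf j : gap g (f j) = 0.
    by have : f j \in zeros g; [rewrite zg imset_f | rewrite inE => /eqP].
  rewrite (det_lift_homog _ gf) pmulr_rlt0 // lt_def.
  have -> /= : gap g i <= 0.
    rewrite leNgt; apply: contra iQ => gi; apply: (fintype.subsetP pos).
    by rewrite inE.
  by move: ig; rewrite inE eq_sym andbT.
have [f [f_inj zg fU]] := basis_frame vg.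
move: fU; rewrite unitmxE unitfE neq_lt => /orP[detf|]; last by exists f.
(* A negatively oriented frame is corrected by exchanging two of its entries; [d_ge1] provides two
   positions. *)
have d2 : (1 < d + 1)%N by rewrite addn1.
pose s := tperm (Ordinal (ltnW d2)) (Ordinal d2).
exists (f \o s); split.
- by move=> x y /f_inj/perm_inj.
- apply/setP => k; rewrite zg; apply/imsetP/imsetP => -[j _ ->].
    by exists (s j); rewrite //= tpermK.
  by exists (s j).
have -> : \matrix_j homog a ((f \o s) j) = row_perm s (\matrix_j homog a (f j)).
  by apply/matrixP => j k; rewrite !mxE.
by rewrite row_permE det_mulmx det_perm odd_tperm /= mulN1r oppr_gt0.
Qed.

End Vertices.

(** * Linear programming duality for points of the zonotope *)

Section Tiling.
Variables (R : realType) (d n : nat) (a : 'I_n -> 'rV[R]_d) (h : 'I_n -> R).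
Hypothesis h_generic : generic_height a h.
Implicit Types (I B S Q : {set 'I_n}) (g u : 'cV[R]_(d + 1)) (c : 'I_n -> R).
Local Notation gap := (gap a h).
Local Notation zeros := (zeros a h).
Local Notation positives := (positives a h).
Local Notation vertex := (vertex a h).

(** Recording all coefficients, with 1 on [I] and 0 off both sets, lets coefficients from different
    cells be compared index by index. *)
Lemma cellP m (x : 'I_n -> 'rV[R]_m) I B y : [disjoint I & B]%B ->
  cell x I B y <-> exists c, [/\ forall i, 0 <= c i <= 1, y = \sum_i c i *: x i,
    forall i, i \in I -> c i = 1 & forall i, i \notin (I :|: B)%SET -> c i = 0].
Proof.
move=> dIB; split=> [[c [c01 ->]]|[c [c01 -> cI c0]]].
  exists (fun i => if i \in I then 1 else if i \in B then c i else 0).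
  split=> [i||i ->//|i].
  - by case: ifP => _; [rewrite ler01 lexx | case: ifP => _ //; rewrite lexx ler01].
  - rewrite big_mkcond (big_mkcond (mem B)) -big_split /=; apply: eq_bigr => i _.
    case: ifP => [iI|_]; first by rewrite (disjointFr dIB iI) scale1r addr0.
    by case: ifP; rewrite ?scale0r add0r.
  - by rewrite finset.in_setU negb_or => /andP[/negPf-> /negPf->].
exists c; split=> //; apply/esym.
rewrite big_mkcond (big_mkcond (mem B)) -big_split /=; apply: eq_bigr => i _.
have [iI|iI] := boolP (i \in I); first by rewrite (disjointFr dIB iI) addr0 cI ?scale1r.
have [iB|iB] := boolP (i \in B); first by rewrite add0r.
by rewrite c0 ?scale0r ?addr0 // finset.in_setU negb_or iI.
Qed.

Lemma zonotopeP m (x : 'I_n -> 'rV[R]_m) y : zonotope x y <->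
  exists2 c, forall i, 0 <= c i <= 1 & y = \sum_i c i *: x i.
Proof.
rewrite /zonotope cellP; last by rewrite -finset.setI_eq0 finset.set0I.
split=> [[c [c01 yc _ _]]|[c c01 yc]]; exists c => //; split=> // i; rewrite !inE //.
Qed.

(** The negative of the Lagrangian dual objective at the multiplier [g], for the program minimising
    [\sum_i c i * h i] over coefficients in [0, 1] that represent [y]. *)
Definition support_gap (y : 'rV[R]_(d + 1)) g : R :=
  \sum_i Num.max 0 (gap g i) - (y *m g) 0 0.

Lemma gap_comb (P : pred 'I_n) c g : \sum_(i | P i) c i * gap g i =
  ((\sum_(i | P i) c i *: homog a i) *m g) 0 0 - \sum_(i | P i) c i * h i.
Proof.
rewrite (value_comb a _ _ c id g) -sumrB.
by apply: eq_bigr => i _; rewrite /gap mulrBr.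
Qed.

(** Weak duality: each [c i * gap g i] is at most [Num.max 0 (gap g i)]. *)
Lemma support_gap_ge c g : (forall i, 0 <= c i <= 1) ->
  - (\sum_i c i * h i) <= support_gap (\sum_i c i *: homog a i) g.
Proof.
move=> c01; rewrite /support_gap -lerBlDr opprK [X in X <= _]addrC -gap_comb.
apply: ler_sum => i _; have /andP[c0 c1] := c01 i.
have [g0|g0] := leP 0 (gap g i); last by rewrite nmulr_lle0.
by rewrite ler_piMl.
Qed.

(** As long as no gap changes sign, every maximum is linear along the edge. The coordinates [c] of
    [y] in the tile then cancel all contributions to the slope but that of [j]. *)
Lemma support_gap_edge c g u j (t : R) (y : 'rV[R]_(d + 1)) : 0 < t -> j \in zeros g ->
  (forall b, b \in zeros g -> b != j -> value a u b = 0) ->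
  (forall k, k \notin zeros g ->
     (0 < gap g k -> 0 <= gap (g + t *: u) k) /\
     (gap g k < 0 -> gap (g + t *: u) k <= 0)) ->
  y - \sum_(i in positives g) homog a i = \sum_(b in zeros g) c b *: homog a b ->
  support_gap y (g + t *: u) =
  support_gap y g + t * (Num.max 0 (value a u j) - c j * value a u j).
Proof.
move=> t0 jg u0 sgn yE; rewrite /support_gap.
have -> : (y *m (g + t *: u)) 0 0 = (y *m g) 0 0 + t * (y *m u) 0 0.
  by rewrite mulmxDr -scalemxAr !mxE.
have -> : (y *m u) 0 0 = \sum_(i in positives g) value a u i + c j * value a u j.
  rewrite -[y](subrK (\sum_(i in positives g) homog a i)) yE addrC mulmxDl mxE.
  congr (_ + _).
    by rewrite mulmx_suml summxE.
  rewrite (value_comb a _ _ c id u) (big_setD1 j) //= big1 ?addr0 // => b.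
  by rewrite !inE => /andP[bj bg]; rewrite u0 ?mulr0 ?inE.
suff -> : \sum_i Num.max 0 (gap (g + t *: u) i) = \sum_i Num.max 0 (gap g i) +
    t * \sum_(i in positives g) value a u i + t * Num.max 0 (value a u j) by lra.
rewrite [in t * \sum_(_ in _) _]big_mkcond mulr_sumr -big_split /=.
rewrite [in RHS](bigD1 j) //= [LHS](bigD1 j) //= addrAC; congr (_ + _).
  move: jg; rewrite gapD !inE => /eqP->; rewrite ltxx maxxx mulr0 !add0r.
  by rewrite maxr_pMr ?mulr0 // ltW.
apply: eq_bigr => k kj; rewrite inE.
have [kg|kg] := boolP (k \in zeros g).
  rewrite gapD u0 // mulr0 addr0; move: kg; rewrite inE => /eqP->.
  by rewrite ltxx mulr0 addr0.
have [s1 s2] := sgn k kg; move: kg; rewrite inE.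
case: ltgtP => // gk _.
  by rewrite -gapD !max_r ?s1 // ltW.
by rewrite mulr0 addr0 !max_l ?s2 // ltW.
Qed.

(** At a vertex minimising [support_gap y] the coordinates of [y] lie in [0, 1]: otherwise some edge
    descends, either to a vertex with a smaller value or along a ray violating weak duality. *)
Lemma tiles_cover y : (exists B, is_basis a B) -> zonotope (homog a) y ->
  exists2 g, vertex g & tile a (positives g, zeros g) y.
Proof.
case=> B0 /(vertex_of_basis h_generic)[g0 _ vg0] /zonotopeP[w w01 yw].
have [g [vg _ ming]] := min_vertex (Pr := fun=> True) (support_gap y) vg0 I.
exists g => //.
have [c yc] := basis_span (y - \sum_(i in positives g) homog a i) vg.
have c01 j : j \in zeros g -> 0 <= c j <= 1.
  move=> jg; apply: contraT => cj.
  (* The direction is chosen so that the slope [Num.max 0 s - c j * s] is [c j] when [c j < 0] and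
     [1 - c j] when [c j > 1], negative in both cases. *)
  pose s : R := if c j < 0 then -1 else 1.
  have s0 : s != 0 by rewrite /s; case: ifP; rewrite ?oppr_eq0 oner_eq0.
  have ks : Num.max 0 s - c j * s < 0.
    rewrite /s; case: ifP cj => [cj _|]; first by rewrite max_l ?lerN10 //; lra.
    rewrite ltNge => /negbFE-> /=; rewrite -ltNge => cj.
    by rewrite max_r ?ler01 //; lra.
  have [u uB] := basis_interpolation (fun k => if k == j then s else 0) vg.
  have uj : value a u j = s by rewrite uB // eqxx.
  have u0 b : b \in zeros g -> b != j -> value a u b = 0.
    by move=> bg /negPf bj; rewrite uB ?bj.
  have edge (t : R) (t0 : 0 < t) sgn := support_gap_edge t0 jg u0 sgn yc.
  rewrite uj in edge.
  have [/existsP[i0 i0P]|/existsPn noi] := boolP [exists i, gap g i * value a u i < 0].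
    have [|t [i [t0 ig zg' vg' sg']]] := pivot h_generic vg jg u0 _ i0P.
      by rewrite uj.
    have := ming _ vg' I; rewrite edge //; first by rewrite lerDl pmulr_rge0 // leNgt ks.
    move=> k kg; have [->|ki] := eqVneq k i.
      have : i \in zeros (g + t *: u) by rewrite zg' !inE eqxx.
      by rewrite inE => /eqP->.
    have := sg' k kg ki; case: (ltgtP 0 (gap g k)) => // _.
      by move=> /ltW.
    by move/negbT; rewrite -leNgt.
  pose K := \sum_i w i * h i.
  have bnd g' : - K <= support_gap y g' by rewrite yw; apply: support_gap_ge.
  pose k := Num.max 0 s - c j * s; rewrite -/k in ks edge.
  have k0 : k != 0 by rewrite lt_eqF.
  (* On the unbounded ray, this [t] makes the objective equal to [- K - 1], below the bound
     [- K]. *)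
  pose t := (support_gap y g + K + 1) / - k.
  have t0 : 0 < t by rewrite divr_gt0 ?oppr_gt0 //; have := bnd g; lra.
  have := bnd (g + t *: u); rewrite edge //.
    by rewrite /t invrN mulrN mulNr divfK //; lra.
  move=> i ig; have := noi i; rewrite -leNgt gapD => giu.
  by split=> gi; nra.
exists (fun i => if i \in zeros g then c i else 0); split=> [i|/=].
  by case: ifP => [/c01//|_]; rewrite lexx ler01.
rewrite -[LHS](subrK (\sum_(i in positives g) homog a i)) yc addrC.
by congr (_ + _); apply: eq_bigr => b ->.
Qed.

Definition tile_coords g c : Prop := [/\ forall i, 0 <= c i <= 1,
  forall i, i \in positives g -> c i = 1 &
  forall i, i \notin (positives g :|: zeros g)%SET -> c i = 0].

Lemma tileP g y : tile a (positives g, zeros g) y <->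
  exists2 c, tile_coords g c & y = \sum_i c i *: homog a i.
Proof.
rewrite /tile cellP; last exact: disjoint_positives_zeros.
by split=> [[c [? ? ? ?]]|[c [? ? ?] ?]]; exists c.
Qed.

(** Tile coefficients are 1 where the gap is positive and 0 where it is negative, so they maximise
    every term separately; the equality case is complementary slackness. *)
Lemma tile_coords_slack g c c' i : tile_coords g c -> (forall i, 0 <= c' i <= 1) ->
  c' i * gap g i <= c i * gap g i ?= iff (gap g i == 0) || (c' i == c i).
Proof.
case=> _ c1 c0 /(_ i)/andP[c'0 c'1].
split; last by rewrite -subr_eq0 -mulrBl mulf_eq0 orbC [X in _ || X]subr_eq0.
have [gi|gi|->] := ltgtP (gap g i) 0; last by rewrite !mulr0.
  by rewrite c0 ?mul0r ?nmulr_lle0 // !inE negb_or lt_eqF // -leNgt ltW.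
by rewrite c1 ?inE // mul1r ler_piMl // ltW.
Qed.

Lemma tile_coords_min g c c' : tile_coords g c -> (forall i, 0 <= c' i <= 1) ->
  \sum_i c i *: homog a i = \sum_i c' i *: homog a i ->
  \sum_i c i * h i <= \sum_i c' i * h i.
Proof.
move=> gc c'01 e.
have : \sum_i c' i * gap g i <= \sum_i c i * gap g i.
  by apply: ler_sum => i _; exact: (tile_coords_slack i gc c'01).1.
by rewrite !gap_comb e lerD2l lerN2.
Qed.

(* The coefficients of a point of a tile minimise [\sum_i c i * h i] among all
   coefficients in [0, 1] of that point, and complementary slackness makes
   the minimiser unique. *)
Lemma tile_coords_inj g g' c c' : vertex g -> tile_coords g c -> tile_coords g' c' ->
  \sum_i c i *: homog a i = \sum_i c' i *: homog a i -> c =1 c'.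
Proof.
move=> vg gc g'c' e; have [c01 _ _] := gc; have [c'01 _ _] := g'c'.
have eh : \sum_i c i * h i = \sum_i c' i * h i.
  by apply/eqP; rewrite eq_le (tile_coords_min gc c'01 e) (tile_coords_min g'c' c01).
have cc' i : i \notin zeros g -> c i = c' i.
  (* Equal points and equal costs give equal sums of [c i * gap g i], so every termwise inequality
     is an equality. Off [zeros g] this forces equal coefficients. *)
  have /esym/eqP := gap_comb predT c g; rewrite e eh -gap_comb => /eqP eg.
  have := leif_sum (fun i (_ : true) => tile_coords_slack i gc c'01).
  rewrite eg => -[_]; rewrite eqxx => /esym/forallP/(_ i) /=.
  by rewrite inE => /orP[->//|/eqP->].
have eB : \sum_(b in zeros g) c b *: homog a b = \sum_(b in zeros g) c' b *: homog a b.
  have eC : \sum_(i | i \notin zeros g) c i *: homog a i =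
      \sum_(i | i \notin zeros g) c' i *: homog a i by apply: eq_bigr => i /cc'->.
  move: e; rewrite (bigID (mem (zeros g))) [in RHS](bigID (mem (zeros g))) /= eC.
  by move/addIr.
move=> i; have [ig|] := boolP (i \in zeros g); last exact: cc'.
exact: basis_coords_eq eB i ig.
Qed.

End Tiling.

(** * Vertex labels as a fine zonotopal tiling *)

Section VertexTiling.
Variables (R : realType) (d n : nat) (a : 'I_n -> 'rV[R]_d) (h : 'I_n -> R).
Hypothesis h_generic : generic_height a h.
Hypothesis has_basis : exists B, is_basis a B.
Local Notation gap := (gap a h).
Local Notation zeros := (zeros a h).
Local Notation positives := (positives a h).
Local Notation vertex := (vertex a h).

Lemma nbhs_line m (S : set 'rV[R]_m) (x v : 'rV[R]_m) : nbhs x S ->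
  exists2 e, 0 < e & forall t, `|t| < e -> S (x + t *: v).
Proof.
move=> /nbhs_ballP[e /= e0 eS]; exists (e / (`|v| + 1)).
  by rewrite divr_gt0 // ltr_wpDl.
move=> t te; apply: eS; rewrite -ball_normE /ball_ /= opprD addNKr normrN normrZ.
rewrite ltr_pdivlMr ?ltr_wpDl // in te; apply: le_lt_trans te.
by rewrite ler_wpM2l // lerDl.
Qed.

Definition vertex_labels : set (label n) :=
  [set L | exists2 g, vertex g & L = (positives g, zeros g)].

Lemma vertex_label_is_tile L : vertex_labels L -> is_tile a L.
Proof.
by case=> g [zg ind] ->; split=> //; exact: disjoint_positives_zeros.
Qed.

Lemma vertex_label_eq L L' : vertex_labels L -> vertex_labels L' ->
  L.2 \subset L'.2 -> L = L'.
Proof.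
case=> g vg -> [g' vg' ->] /= sub.
have /eqP e : zeros g == zeros g' by rewrite eqEcard sub vg.1 vg'.1 /=.
by rewrite (vertex_eq vg e).
Qed.

(** Small moves along [homog a b] in both directions stay in the tile and, by uniqueness of
    coordinates in a basis, change only the coefficient at [b], which therefore has room on both
    sides. *)
Lemma tile_interior_coords g c : vertex g -> tile_coords a h g c ->
  (tile a (positives g, zeros g))° (\sum_i c i *: homog a i) ->
  forall b, b \in zeros g -> 0 < c b < 1.
Proof.
move=> vg gc int b bg.
have [e e0 he] := nbhs_line (homog a b) int.
have coord t : `|t| < e -> 0 <= c b + t <= 1.
  move=> /he /(tileP _ _ _ _)[c' gc' yc'].
  pose c2 i := c i + (if i == b then t else 0).
  have e2 : \sum_i c i *: homog a i + t *: homog a b = \sum_i c2 i *: homog a i.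
    rewrite (bigD1 b) //= [in RHS](bigD1 b) //= /c2 eqxx scalerDl addrAC.
    congr (_ + _); apply: eq_bigr => i /negPf->.
    by rewrite addr0.
  have [c'01 c'1 c'0] := gc'; have [_ c1 c0] := gc.
  rewrite e2 in yc'.
  have eB : \sum_(i in zeros g) c2 i *: homog a i = \sum_(i in zeros g) c' i *: homog a i.
    have eC : \sum_(i | i \notin zeros g) c2 i *: homog a i =
        \sum_(i | i \notin zeros g) c' i *: homog a i.
      apply: eq_bigr => i ig; rewrite /c2 ifF ?addr0; last first.
        by apply: contraNF ig => /eqP->.
      have [ip|ip] := boolP (i \in positives g); first by rewrite c1 ?c'1.
      by rewrite c0 ?c'0 // finset.in_setU negb_or ip.
    move: yc'; rewrite (bigID (mem (zeros g))) [in RHS](bigID (mem (zeros g))) /= eC.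
    by move/addIr.
  have := basis_coords_eq vg eB bg; rewrite /c2 eqxx => ->.
  exact: c'01.
have e2 : `|e / 2| < e by rewrite gtr0_norm ?divr_gt0 //; lra.
have := coord _ e2; have := coord (- (e / 2)); rewrite normrN => /(_ e2).
by lra.
Qed.

Lemma tiles_meet g g' y : vertex g -> vertex g' ->
  tile a (positives g, zeros g) y -> tile a (positives g', zeros g') y ->
  exists c, [/\ tile_coords a h g c, tile_coords a h g' c & y = \sum_i c i *: homog a i].
Proof.
move=> vg vg' /(tileP _ _ _ _)[c gc yc] /(tileP _ _ _ _)[c' g'c' yc'].
have cc' := tile_coords_inj vg gc g'c' (etrans (esym yc) yc').
exists c; split=> //; have [c01 c1 c0] := g'c'.
by split=> i; rewrite cc'; [exact: c01|exact: c1|exact: c0].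
Qed.

(** A shared coefficient family takes the value 1 on [positives g']; such an index cannot have
    negative gap for [g], where the coefficient would be 0. *)
Lemma meet_is_face g g' (c : 'I_n -> R) : tile_coords a h g c -> tile_coords a h g' c ->
  is_face_label (positives g :|: positives g', zeros g :&: zeros g')%SET
                (positives g, zeros g).
Proof.
move=> [c01 c1 c0] [_ c'1 c'0]; split=> /=; [exact: finset.subsetIl|exact: finset.subsetUl|].
rewrite finset.subUset finset.subsetUl; apply/fintype.subsetP => i ig'.
rewrite finset.in_setU finset.in_setD finset.in_setI.
rewrite (disjointFr (disjoint_positives_zeros a h g') ig') andbF /=.
apply: contraT => ig; have := c'1 i ig'; rewrite c0 ?finset.in_setU //.
by move/eqP; rewrite eq_sym oner_eq0.
Qed.

Lemma face_subset (F L : label n) : is_face_label F L -> [disjoint F.1 & F.2]%B ->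
  [disjoint L.1 & L.2]%B -> tile a F `<=` tile a L.
Proof.
case=> sub2 sub1 subF dF dL y /(cellP _ _ dF)[c [c01 yc c1 c0]].
apply/(cellP _ _ dL); exists c; split=> // i => [iL|].
  by rewrite c1 // (fintype.subsetP sub1).
rewrite !finset.in_setU !negb_or => /andP[i1 i2].
rewrite c0 // finset.in_setU negb_or (contra (fintype.subsetP sub2 i)) // andbT.
apply: contra (fintype.subsetP subF i) _.
by rewrite finset.in_setU finset.in_setD negb_or i1 negb_and i2 orbT.
Qed.

Lemma vertex_labels_tiling : fine_zonotopal_tiling a vertex_labels.
Proof.
split; first exact: vertex_label_is_tile.
- apply/seteqP; split=> y.
    case=> _ [g vg ->] /(tileP _ _ _ _)[c [c01 _ _] yc]; apply/zonotopeP.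
    by exists c.
  by case/(tiles_cover h_generic has_basis) => g vg ty; exists (positives g, zeros g) => //; exists g.
- move=> L L' PL PL' LL'; apply/seteqP; split=> // y [yL yL'].
  case: LL'; apply: vertex_label_eq => //.
  case: PL PL' yL yL' => g vg -> [g' vg' ->] yL yL'.
  have [c [gc [_ c1 c0] yc]] :=
    tiles_meet vg vg' (interior_subset yL) (interior_subset yL').
  (* A coefficient at a zero of [g] lies strictly between 0 and 1, whereas off [zeros g'] it is 0 or
     1. *)
  apply/fintype.subsetP => b bg; rewrite yc in yL.
  have /andP[cb0 cb1] := tile_interior_coords vg gc yL bg.
  apply: contraT => bg'; have [/c1 cb|bp'] := boolP (b \in positives g').
    by rewrite cb ltxx in cb1.
  by rewrite c0 ?ltxx // finset.in_setU negb_or bp' in cb0.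
move=> _ _ [g vg ->] [g' vg' ->].
have [[y [/= yg yg']]|none] := pselect (tile a (positives g, zeros g) `&`
    tile a (positives g', zeros g') !=set0); last first.
  by left; apply/eqP/negPn/negP => /set0P.
have [c0 [gc0 g'c0 _]] := tiles_meet vg vg' yg yg'.
(* A common coefficient is fixed to 0 or 1 as soon as one of the two tiles fixes it, so only the
   indices in both zero sets stay free. *)
pose F : label n := (positives g :|: positives g', zeros g :&: zeros g')%SET.
have FL := meet_is_face gc0 g'c0.
have FL' : is_face_label F (positives g', zeros g').
  by rewrite /F finset.setUC finset.setIC; exact: meet_is_face gc0.
have dg := disjoint_positives_zeros a h g; have dg' := disjoint_positives_zeros a h g'.
have dF : [disjoint F.1 & F.2]%B.
  rewrite -finset.setI_eq0 -finset.subset0; apply/fintype.subsetP => i.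
  rewrite finset.in_setI finset.in_setU finset.in_setI => /and3P[/orP[ip|ip] ig ig'].
    by rewrite (disjointFr dg ip) in ig.
  by rewrite (disjointFr dg' ip) in ig'.
right; exists F; split=> //; apply/seteqP; split=> z; last first.
  by move=> zF; split; [exact: face_subset FL dF dg _ zF|exact: face_subset FL' dF dg' _ zF].
case=> zg zg'; have [c [[c01 c1 c0'] [_ c1' c0''] zc]] := tiles_meet vg vg' zg zg'.
apply/(cellP _ _ dF); exists c; split=> // i.
  by rewrite finset.in_setU => /orP[/c1|/c1'].
rewrite !finset.in_setU finset.in_setI !negb_or negb_and => /andP[/andP[ip ip']].
by case/orP => ig; [rewrite c0'|rewrite c0'']; rewrite // finset.in_setU negb_or ?ip ?ip'.
Qed.

End VertexTiling.

(** * Link regions and the levels of the procedure *)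

Section Procedure.
Variables (R : realType) (d n : nat) (a : 'I_n -> 'rV[R]_d) (h : 'I_n -> R).
Implicit Types (B Q : {set 'I_n}) (g u : 'cV[R]_(d + 1)) (x : 'rV[R]_d).
Local Notation gap := (gap a h).
Local Notation zeros := (zeros a h).
Local Notation positives := (positives a h).
Local Notation vertex := (vertex a h).
Local Notation vertex_labels := (vertex_labels a h).

Definition open_simplex B : set 'rV[R]_d :=
  [set x | exists c : 'I_n -> R, [/\ forall b, b \in B -> 0 < c b,
     \sum_(b in B) c b = 1 & x = \sum_(b in B) c b *: a b] ].

Lemma nbhs_affine_gt0 x u : 0 < (row_mx x (const_mx 1) *m u) 0 0 ->
  nbhs x [set y : 'rV[R]_d | 0 < (row_mx y (const_mx 1) *m u) 0 0].
Proof.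
have affE (y : 'rV[R]_d) : (row_mx y (const_mx 1) *m u) 0 0 =
    \sum_j y 0 j * usubmx u j 0 + dsubmx u 0 0.
  rewrite -{1}[u]vsubmxK mul_row_col mxE [X in _ + X]mxE big_ord1.
  by rewrite [const_mx 1 _ _]mxE mul1r mxE.
rewrite affE; set l := _ + _ => l0.
pose W := \sum_j `|usubmx u j 0|.
have W0 : 0 <= W by apply: sumr_ge0.
apply/nbhs_ballP; exists (l / (W + 1)); first by rewrite /= divr_gt0 // ltr_wpDl.
move=> y [_ xy] /=; rewrite affE.
have : `|\sum_j (x 0 j - y 0 j) * usubmx u j 0| <= l / (W + 1) * W.
  apply: le_trans (ler_norm_sum _ _ _) _; rewrite mulr_sumr; apply: ler_sum => j _.
  by rewrite normrM ler_wpM2r // ltW //; exact: xy.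
have : l / (W + 1) * W < l.
  by rewrite mulrAC ltr_pdivrMr ?ltr_wpDl // ltr_pM2l // ltrDl.
rewrite (eq_bigr (fun j => x 0 j * usubmx u j 0 - y 0 j * usubmx u j 0)); last first.
  by move=> j _; rewrite mulrBl.
rewrite sumrB; set eps := l / _ * _ => eps_l /ler_normlP[_].
by rewrite /l in eps_l; lra.
Qed.

Lemma affine_coords B x : is_basis a B ->
  exists c, \sum_(b in B) c b = 1 /\ x = \sum_(b in B) c b *: a b.
Proof.
move=> basB; have [c] := basis_span (row_mx x (const_mx 1)) basB.
rewrite homog_comb => /eq_row_mx[xc /rowP/(_ 0)]; rewrite !mxE => c1.
by exists c.
Qed.

(** Barycentric coordinates in an affine basis are affine functions, so their positivity is a finite
    conjunction of open conditions. *)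
Lemma open_simplex_open B x : is_basis a B -> open_simplex B x -> nbhs x (open_simplex B).
Proof.
move=> basB [c [c0 c1 xc]].
have /choice[u uB] : forall b, exists u, b \in B ->
    forall k, k \in B -> value a u k = (k == b)%:R.
  move=> b; have [u uB] := basis_interpolation (fun k => (k == b)%:R) basB.
  by exists u.
have coordE (c' : 'I_n -> R) (y : 'rV[R]_d) b : b \in B ->
    \sum_(k in B) c' k = 1 -> y = \sum_(k in B) c' k *: a k ->
    (row_mx y (const_mx 1) *m u b) 0 0 = c' b.
  move=> bB c'1 ->; rewrite -c'1 -homog_comb (value_comb a _ _ c' id).
  rewrite (big_setD1 b) //= uB // eqxx mulr1 big1 ?addr0 // => k.
  by rewrite !inE => /andP[/negPf kb kB]; rewrite uB // kb mulr0.
have : nbhs x [set y : 'rV[R]_d | forall b, b \in B ->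
    0 < (row_mx y (const_mx 1) *m u b) 0 0].
  apply: (@filter_forall _ _ (fun b => [set y : 'rV[R]_d | b \in B ->
    0 < (row_mx y (const_mx 1) *m u b) 0 0]) (nbhs x)) => b.
  have [bB|bB] := boolP (b \in B); last first.
    by apply: filterS (filterT : nbhs x setT) => y _.
  have : 0 < (row_mx x (const_mx 1) *m u b) 0 0 by rewrite (coordE c) ?c0.
  by move/nbhs_affine_gt0; apply: filterS => y /= y0 _.
apply: filterS => y yB; have [c' [c'1 yc']] := affine_coords y basB.
by exists c'; split=> // b bB; rewrite -(coordE c' y b) ?yB.
Qed.

Lemma barycenter B : (0 < #|B|)%N -> open_simplex B !=set0.
Proof.
move=> B0; exists (\sum_(b in B) (#|B|%:R)^-1 *: a b), (fun=> (#|B|%:R)^-1).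
split=> // [b _|]; first by rewrite invr_gt0 ltr0n.
by rewrite sumr_const -[LHS]mulr_natl mulfV // pnatr_eq0 -lt0n.
Qed.

Lemma open_simplex_conv B : open_simplex B `<=` conv a B.
Proof.
move=> x [c [c0 c1 ->]]; exists (fun i => if i \in B then c i else 0).
split=> [i||]; first by case: ifP => // /c0/ltW.
  by rewrite -c1; apply: eq_bigr => i ->.
by apply: eq_bigr => i ->.
Qed.

(** Moving a point of the hull slightly towards the barycenter makes all its coordinates
    positive. *)
Lemma conv_closure_open_simplex B : (0 < #|B|)%N ->
  conv a B `<=` closure (open_simplex B).
Proof.
move=> B0 x [c [c0 c1 xc]] U xU.
have [p [w [w0 w1 pw]]] := barycenter B0.
have [e e0 eU] := nbhs_line (p - x) xU.
pose t := Num.min (e / 2) 1.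
have t0 : 0 < t by rewrite lt_min ltr01 divr_gt0.
have t1 : t <= 1 by rewrite ge_min lexx orbT.
exists (x + t *: (p - x)); split; last first.
  apply: eU; rewrite gtr0_norm //; have : t <= e / 2 by rewrite ge_min lexx.
  by move=> te; lra.
exists (fun b => (1 - t) * c b + t * w b); split.
- move=> b bB; have := c0 b; have := w0 b bB => wb cb.
  by rewrite ltr_wpDl ?mulr_gt0 ?mulr_ge0 // subr_ge0.
- by rewrite big_split -!mulr_sumr c1 w1 !mulr1 /= subrK.
rewrite xc pw -sumrB scaler_sumr -big_split; apply: eq_bigr => b _ /=.
by rewrite -scalerBl scalerA -scalerDl; congr (_ *: _); lra.
Qed.

Lemma conv_subset B Q : B \subset Q -> conv a B `<=` conv a Q.
Proof.
move=> /fintype.subsetP BQ x [c [c0 c1 xc]]; exists (fun i => if i \in B then c i else 0).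
split=> [i||]; first by case: ifP.
  rewrite -c1 big_mkcond [RHS]big_mkcond; apply: eq_bigr => i _ /=.
  by case: ifP => // iQ; case: ifP => // /BQ; rewrite iQ.
rewrite xc big_mkcond [RHS]big_mkcond; apply: eq_bigr => i _ /=.
by case: ifP => iB; [rewrite BQ|case: ifP; rewrite ?scale0r].
Qed.

(* T_Q(h) is the lower envelope of the lifted points outside Q: at a common
   point of two simplices both affine functions agree. *)
Lemma delaunay_simplices_disjoint g g' Q : vertex g -> vertex g' ->
  [disjoint zeros g & Q]%B -> [disjoint zeros g' & Q]%B ->
  positives g \subset Q -> positives g' \subset Q ->
  open_simplex (zeros g) `&` conv a (zeros g') !=set0 -> g = g'.
Proof.
move=> vg vg' dg dg' pg pg' [x [[c [c0 c1 xc]] [c' [c'0 c'1 xc']]]].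
have gap0 k b : b \in zeros k -> gap k b = 0 by rewrite inE => /eqP.
have gap_le0 k b : positives k \subset Q -> b \notin Q -> gap k b <= 0.
  move=> /fintype.subsetP kQ bQ; rewrite leNgt; apply: contra bQ => kb.
  by apply: kQ; rewrite inE.
have e : \sum_(b in zeros g) c b *: homog a b = \sum_(b in zeros g') c' b *: homog a b.
  by rewrite !homog_comb c1 c'1 -xc -xc'.
have s1 : \sum_(b in zeros g) c b * gap g b = 0.
  by rewrite big1 // => b /gap0->; rewrite mulr0.
have s2 : \sum_(b in zeros g') c' b * gap g' b = 0.
  by rewrite big1 // => b /gap0->; rewrite mulr0.
have s3 : \sum_(b in zeros g') c' b * gap g b <= 0.
  apply: sumr_le0 => b bg'; apply: mulr_ge0_le0 => //; apply: gap_le0 => //.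
  by rewrite (disjointFr dg' bg').
have s4 b : b \in zeros g -> 0 <= - (c b * gap g' b).
  move=> bg; rewrite oppr_ge0; apply: mulr_ge0_le0; first by rewrite ltW ?c0.
  apply: gap_le0 => //.
  by rewrite (disjointFr dg bg).
have s5 : \sum_(b in zeros g) - (c b * gap g' b) = 0.
  apply/eqP; rewrite eq_le sumr_ge0 // andbT sumrN oppr_le0.
  by rewrite gap_comb e; move: s1 s2 s3; rewrite !gap_comb e; lra.
have sub : zeros g \subset zeros g'.
  apply/fintype.subsetP => b bg; have := psumr_eq0P s4 s5 bg.
  by move/eqP; rewrite oppr_eq0 mulf_eq0 gt_eqF ?c0 //= inE.
have /eqP zz : zeros g == zeros g' by rewrite eqEcard sub vg.1 vg'.1 /=.
exact: vertex_eq vg zz.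
Qed.

(** If [positives g] is smaller than [Q], the simplex was already produced at an earlier level and
    is removed. If it equals [Q], an earlier simplex meeting the open one would come from [g]
    itself, whose level is too high. *)
Lemma conv_link_region (Ps : seq (set (label n))) g Q : vertex g ->
  (forall r, (r < #|Q|)%N -> nth set0 Ps r = [set L | vertex_labels L /\ #|L.1| = r]) ->
  [disjoint zeros g & Q]%B -> positives g \subset Q ->
  conv a (zeros g) `<=` link_region a Ps Q <-> positives g = Q.
Proof.
move=> vg PsE dg pg.
have z0 : (0 < #|zeros g|)%N by rewrite vg.1.
split=> [sub|pgQ].
  apply/eqP; apply: contraT => pgQ.
  have ltQ : (#|positives g| < #|Q|)%N.
    by apply: proper_card; rewrite finset.properEneq pgQ.
  have [p po] := barycenter z0.
  (* The region is a closure, so the barycenter may lie in it without surviving the removal; a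
     nearby interior point [q] survives and is still in the simplex. *)
  have /(_ _ (open_simplex_open vg po))[q [qint qo]] := sub p (open_simplex_conv po).
  have [_ []] := interior_subset qint.
  exists #|positives g| => //=; exists (positives g, zeros g); last exact: open_simplex_conv.
  by split=> //; rewrite PsE //; split=> //; exists g.
apply: subset_trans (conv_closure_open_simplex z0) _.
apply: closure_subset => x xo.
rewrite /interior; apply: filterS (open_simplex_open vg xo) => y yo.
split.
  apply: (@conv_subset (zeros g)); last exact: open_simplex_conv.
  by rewrite -finset.disjoints_subset.
case=> r /= rQ [L [PL dL LQ] yL].
move: PL; rewrite PsE // => -[[g' vg' Lg'] Lr].
rewrite {}Lg' /= in dL LQ yL Lr.
have gg' : g = g'.
  by apply: (delaunay_simplices_disjoint vg vg' dg dL pg LQ); exists y.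
by move: rQ; rewrite -Lr -gg' pgQ ltnn.
Qed.

Hypothesis h_generic : generic_height a h.
Hypothesis d_ge1 : (1 <= d)%N.

Lemma level_tiles_vertex_labels k :
  level_tiles a h k = [set L | vertex_labels L /\ #|L.1| = k].
Proof.
elim/ltn_ind: k => k IHk.
have PsE j : (j <= k)%N -> forall r, (r < j)%N ->
    nth set0 (history a h j) r = [set L | vertex_labels L /\ #|L.1| = r].
  by move=> jk r rj; rewrite nth_history // IHk // (leq_trans rj).
rewrite level_tilesE; apply/seteqP; split=> [[Q B] [/= Qk]|_ [[g vg ->]] /= pgk].
  move=> /(weighted_delaunayP h_generic _ _ d_ge1)[g [vg <- dg pg]].
  (* The added [b] is a zero of the earlier vertex, hence outside its positive set, so each level
     adds exactly one element. *)
  have Qcard : #|Q| = k.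
    case: k IHk PsE Qk => [_ _ ->|k IHk _]; first by rewrite cards0.
    rewrite index_setsS => -[I [C [b [IC bC -> _]]]].
    move: IC; rewrite IHk // => -[[g' vg' [Ig' Cg']] /= Ik].
    rewrite cardsU1 Ik Ig' (disjointFl (disjoint_positives_zeros a h g')) //.
    by rewrite -Cg'.
  rewrite conv_link_region // => [pgQ|r].
    by rewrite -pgQ in Qcard *; split=> //; exists g.
  by rewrite Qcard; exact: PsE.
have link j : (j <= k)%N -> #|positives g| = j ->
    conv a (zeros g) `<=` link_region a (history a h j) (positives g).
  move=> jk pgj; apply/conv_link_region => //; rewrite ?pgj; first exact: PsE.
  by rewrite disjoint_sym disjoint_positives_zeros.
split; last exact: link.
  case: k IHk PsE pgk link => [_ _ /cards0_eq-> _|k IHk _ pgk link] //.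
  have [i0 i0g] : exists i0, i0 \in positives g by apply/card_gt0P; rewrite pgk.
  (* The simplex step exhibits [positives g] as a set formed from the previous level; its link
     region is nonempty because it contains the simplex of [g]. *)
  have [g' [j [vg' jg' pgE]]] := lower_neighbour h_generic vg i0g.
  rewrite index_setsS; exists (positives g'), (zeros g'), j; split=> //.
    rewrite IHk //; split; first by exists g'.
    move: pgk; rewrite pgE cardsU1 (disjointFl (disjoint_positives_zeros a h g') jg').
    by case.
  have [p /open_simplex_conv pc] : open_simplex (zeros g) !=set0.
    by apply: barycenter; rewrite vg.1.
  by exists p; exact: link.
apply/(weighted_delaunayP h_generic _ _ d_ge1); exists g; split=> //.
by rewrite disjoint_sym disjoint_positives_zeros.
Qed.

(** The last level loses no vertex: the positive set is disjoint from the d + 1 zeros, so it has at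
    most [n - d - 1] elements. *)
Lemma produced_tiling_vertex_labels : produced_tiling a h = vertex_labels.
Proof.
apply/seteqP; split=> [L [k _]|L PL].
  by rewrite level_tiles_vertex_labels => -[].
exists #|L.1|; last by rewrite level_tiles_vertex_labels.
case: PL => g vg -> /=.
have cardn S : (#|S : {set 'I_n}| <= n)%N by rewrite -[leqRHS]card_ord max_card.
rewrite -subnDA leq_subRL addn1 -vg.1 //.
have := cardsUI (zeros g) (positives g).
by rewrite finset.setIC (disjoint_setI0 (disjoint_positives_zeros a h g)) cards0 addn0 => <-.
Qed.

End Procedure.

(** * Upper facets of the lifted zonotope *)

Section Regularity.
Variables (R : realType) (d n : nat) (a : 'I_n -> 'rV[R]_d) (h : 'I_n -> R).
Implicit Types (g u : 'cV[R]_(d + 1)) (N y : 'rV[R]_(d + 1 + 1)).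
Local Notation gap := (gap a h).
Local Notation zeros := (zeros a h).
Local Notation positives := (positives a h).
Local Notation vertex := (vertex a h).
Local Notation vertex_labels := (vertex_labels a h).
Local Notation lift := (lift_homog a (fun i => - h i)).

Lemma sum_setT (T : finType) (V : nmodType) (F : T -> V) :
  \sum_(i in [set: T]%SET) F i = \sum_i F i.
Proof. by apply: eq_bigl => i; rewrite inE. Qed.

Lemma dot_comb m (N : 'rV[R]_m) (c : 'I_n -> R) (x : 'I_n -> 'rV[R]_m) :
  dot N (\sum_i c i *: x i) = \sum_i c i * dot N (x i).
Proof.
rewrite /dot linear_sum mulmx_sumr summxE; apply: eq_bigr => i _.
by rewrite linearZ /= -scalemxAr mxE.
Qed.

(** The functional is maximised generator by generator; comparison with the sum of the positive
    generators forces all coefficients off the orthogonal ones. *)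
Lemma face_of_zonotope m (x : 'I_n -> 'rV[R]_m) (N : 'rV[R]_m) : face_of (zonotope x) N =
  cell x [set i | 0 < dot N (x i)]%SET [set i | dot N (x i) == 0]%SET.
Proof.
set I := [set i | 0 < _]%SET; set B := [set i | _ == 0]%SET.
have dIB : [disjoint I & B]%B := disjoint_gt0_eq0 _.
have le_ind (c : 'I_n -> R) i : 0 <= c i <= 1 ->
    c i * dot N (x i) <= (i \in I)%:R * dot N (x i).
  move=> /andP[c0 c1]; rewrite inE; case: ltP => Ni; last by rewrite mul0r mulr_ge0_le0.
  by rewrite mul1r ler_piMl // ltW.
apply/seteqP; split=> y.
  case=> /zonotopeP[c c01 yc] ymax; apply/(cellP _ _ dIB).
  have /ymax : zonotope x (\sum_i (i \in I)%:R *: x i).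
    apply/zonotopeP; exists (fun i => (i \in I)%:R) => // i.
    by case: (i \in I); rewrite lexx ler01.
  rewrite yc !dot_comb -subr_le0 -sumrB => le0.
  have s0 i : true -> 0 <= (i \in I)%:R * dot N (x i) - c i * dot N (x i).
    by move=> _; rewrite subr_ge0 le_ind.
  have /(psumr_eq0P s0) eq0 :
      \sum_i ((i \in I)%:R * dot N (x i) - c i * dot N (x i)) = 0.
    by apply/eqP; rewrite eq_le le0 sumr_ge0.
  have cI i : i \notin B -> c i = (i \in I)%:R.
    rewrite inE => Ni; apply: (mulIf Ni); apply/eqP.
    by rewrite eq_sym -subr_eq0 eq0.
  exists c; split=> // i iI; last first.
    by move: iI; rewrite finset.in_setU negb_or => /andP[/negPf iI /cI->]; rewrite iI.
  by rewrite cI ?iI // (disjointFr dIB iI).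
case/(cellP _ _ dIB) => c [c01 yc cI c0]; split; first by apply/zonotopeP; exists c.
move=> _ /zonotopeP[w w01 ->]; rewrite yc !dot_comb; apply: ler_sum => i _.
apply: le_trans (le_ind w i (w01 i)) _.
have [iI|iI] := boolP (i \in I); first by rewrite cI.
rewrite mul0r; have [|iB] := boolP (i \in B).
  by rewrite inE => /eqP->; rewrite mulr0.
by rewrite c0 ?mul0r // finset.in_setU negb_or iI.
Qed.

Lemma forget_height_comb m (c : 'I_m -> R) (x : 'I_m -> 'rV[R]_(d + 1 + 1)) :
  forget_height (\sum_i c i *: x i) = \sum_i c i *: forget_height (x i).
Proof.
rewrite /forget_height !linear_sum /= -[RHS]hsubmxK !linear_sum /=.
by congr row_mx; apply: eq_bigr => i _; rewrite !linearZ /= ?row_mxKl ?row_mxKr.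
Qed.

Lemma forget_height_lift eta i : forget_height (lift_homog a eta i) = homog a i.
Proof. by rewrite /forget_height /lift_homog /lift_pt !row_mxKl row_mxKr. Qed.

Definition normal_affine N : 'cV[R]_(d + 1) := (forget_height N)^T.

Lemma dot_forget_height N y :
  dot N y = (forget_height y *m normal_affine N) 0 0 + height_coord N * height_coord y.
Proof.
rewrite /dot -{1}[N]hsubmxK -{1}[y]hsubmxK tr_row_mx mul_row_col.
rewrite -{1}[lsubmx N]hsubmxK -{1}[lsubmx y]hsubmxK tr_row_mx mul_row_col.
rewrite /normal_affine /forget_height tr_row_mx mul_row_col.
rewrite ![(_ + _ : 'M_1) _ _]mxE addrAC; congr (_ + _ + _); last first.
- by rewrite mxE big_ord1 [_^T _ _]mxE.
- by rewrite !mxE; apply: eq_bigr => i _; rewrite !mxE mulrC.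
- by rewrite !mxE; apply: eq_bigr => i _; rewrite !mxE mulrC.
Qed.

Lemma eq0_forget_height y : forget_height y = 0 -> height_coord y = 0 -> y = 0.
Proof.
rewrite /forget_height -[X in _ = X]row_mx0 => /eq_row_mx[y1 y3] y2.
rewrite -[y]hsubmxK y3 -[lsubmx y]hsubmxK y1 (_ : rsubmx (lsubmx y) = 0) ?row_mx0 //.
by apply/rowP => i; rewrite ord1 [LHS]y2 mxE.
Qed.

Lemma dot_lift N i : dot N (lift i) = value a (normal_affine N) i - height_coord N * h i.
Proof.
rewrite dot_forget_height forget_height_lift -mulrN; congr (_ + _ * _).
by rewrite /height_coord /lift_homog /lift_pt row_mxKl row_mxKr mxE.
Qed.

Lemma face_projection eta N (L : label n) : normal_label a eta N = L ->
  tile a L = @forget_height R d @` face_of (lifted_zonotope a eta) N.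
Proof.
move=> <-; rewrite /lifted_zonotope face_of_zonotope /tile /normal_label /=.
set I := [set i | 0 < _]%SET; set B := [set i | _ == 0]%SET.
have dIB : [disjoint I & B]%B := disjoint_gt0_eq0 _.
have fE c : forget_height (\sum_i c i *: lift_homog a eta i) = \sum_i c i *: homog a i.
  by rewrite forget_height_comb; apply: eq_bigr => i _; rewrite forget_height_lift.
apply/seteqP; split=> [y /(cellP _ _ dIB)[c [c01 -> c1 c0]]|_ [y yF <-]].
  by rewrite -fE; exists (\sum_i c i *: lift_homog a eta i) => //; apply/(cellP _ _ dIB); exists c.
case/(cellP _ _ dIB): yF => c [c01 -> c1 c0].
by rewrite fE; apply/(cellP _ _ dIB); exists c.
Qed.

(** Differences of the d + 2 independent points are orthogonal to [N]. Since the height coordinate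
    of [N] is nonzero, forgetting heights keeps them independent, hence spanning. The function [u]
    is constant on the projected facet, so it kills them all. *)
Lemma upper_facet_spanning N u : upper_facet_normal a (fun i => - h i) N ->
  (forall i, dot N (lift i) = 0 -> value a u i = 0) -> u = 0.
Proof.
case=> N0 [p [pF pind]] uB.
pose D (k : 'I_d.+1) := p (fintype.lift ord0 k) - p ord0.
pose D' := \matrix_k forget_height (D k).
have Dcomb (x : 'rV[R]_d.+1) :
    x *m D' = forget_height (\sum_k x 0 k *: D k).
  by rewrite mulmx_sum_row forget_height_comb; apply: eq_bigr => k _; rewrite rowK.
have dotp j : dot N (p j) = dot N (p ord0).
  by apply/eqP; rewrite eq_le; case: (pF j) (pF ord0) => Zj mj [Z0 m0]; rewrite m0 ?mj.
have up j : (forget_height (p j) *m u) 0 0 =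
    \sum_(i | 0 < dot N (lift i)) value a u i.
  have := pF j; rewrite /lifted_zonotope face_of_zonotope.
  case/(cellP _ _ (disjoint_gt0_eq0 _)) => c [_ -> c1 c0].
  rewrite forget_height_comb mulmx_suml summxE big_mkcond /=.
  rewrite [RHS]big_mkcond; apply: eq_bigr => i _.
  rewrite forget_height_lift -scalemxAl mxE -/(value a u i).
  have [Ni|Ni] := ifPn; first by rewrite c1 ?mul1r // inE.
  have [Ni0|Ni0] := eqVneq (dot N (lift i)) 0; first by rewrite uB ?mulr0.
  by rewrite c0 ?mul0r // !inE negb_or Ni.
have D'u : D' *m u = 0.
  apply/row_matrixP => k; rewrite row_mul rowK row0; apply/rowP => j.
  rewrite [j]ord1 [RHS]mxE.
  have -> : forget_height (D k) =
      forget_height (p (fintype.lift ord0 k)) - forget_height (p ord0).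
    by rewrite /forget_height opp_row_mx add_row_mx !linearB.
  by rewrite mulmxBl [LHS]mxE [X in _ + X]mxE !up subrr.
have D'free : row_free D'.
  rewrite -kermx_eq0; apply: contraT => /rowV0Pn[x /sub_kermxP].
  rewrite Dcomb => fx0 /eqP[].
  have y0 : \sum_k x 0 k *: D k = 0.
    apply: eq0_forget_height => //; apply: (mulfI (lt0r_neq0 N0)).
    rewrite mulr0; move: (dot_forget_height N (\sum_k x 0 k *: D k)).
    rewrite fx0 mul0mx [X in X + _]mxE add0r => <-.
    rewrite /dot linear_sum mulmx_sumr summxE big1 // => k _.
    rewrite linearZ /= -scalemxAr mxE linearB mulmxBr /= [X in _ * X]mxE.
    by rewrite [X in _ + X]mxE -!/(dot N _) dotp subrr mulr0.
  apply/rowP => k; rewrite [RHS]mxE.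
  (* A relation among differences becomes an affine relation among the points once [p ord0] receives
     minus the sum of the coefficients. *)
  pose c j := if unlift ord0 j is Some k then x 0 k else - \sum_k x 0 k.
  have cS k' : c (fintype.lift ord0 k') = x 0 k' by rewrite /c liftK.
  have c0 : c ord0 = - \sum_k x 0 k by rewrite /c unlift_none.
  rewrite -cS; apply: (pind c); last by rewrite inE.
    rewrite sum_setT big_ord_recl c0 [X in _ + X](eq_bigr (fun k => x 0 k)) ?addNr //.
  rewrite sum_setT big_ord_recl c0 [X in _ + X](eq_bigr (fun k => x 0 k *: p (fintype.lift ord0 k))).
    rewrite -[RHS]y0 /D [RHS](eq_bigr (fun k => x 0 k *: p (fintype.lift ord0 k) - x 0 k *: p ord0)).
      by rewrite sumrB -scaler_suml scaleNr addrC.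
    by move=> k' _; rewrite scalerBr.
  by move=> k' _; rewrite cS.
have /row_fullP[E ED'] : row_full D'.
  by move: D'free; rewrite /row_free /row_full -[X in _ == X]addn1.
by rewrite -[u]mul1mx -ED' -mulmxA D'u mulmx0.
Qed.

(** The corner [w] and its translates by the generators in [zeros g] are d + 2 points of the face;
    they are independent because forgetting heights sends those generators to a basis. *)
Lemma vertex_upper_facet g N : vertex g -> height_coord N = 1 -> normal_affine N = g ->
  upper_facet_normal a (fun i => - h i) N.
Proof.
move=> vg N1 Ng; split; first by rewrite N1.
have [f [f_inj zf fU]] := basis_frame vg.
pose w := \sum_(i in positives g) lift i.
pose fc (k : 'I_d.+1) := f (cast_ord (esym (addn1 d)) k).
exists (fun j => if unlift ord0 j is Some k then w + lift (fc k) else w); split=> [j|c].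
  have -> : face_of (lifted_zonotope a (fun i => - h i)) N =
      cell lift (positives g) (zeros g).
    rewrite [LHS]face_of_zonotope; congr cell; apply/setP => i.
      by rewrite !inE dot_lift Ng N1 mul1r.
    by rewrite !inE dot_lift Ng N1 mul1r.
  case: (unlift ord0 j) => [k|].
    exists (fun i => (i == fc k)%:R); split=> [i|].
      by case: (_ == _); rewrite lexx ler01.
    have fkz : fc k \in zeros g by rewrite zf; apply: imset_f.
    congr (_ + _); rewrite (bigD1 (fc k)) //= eqxx scale1r big1 ?addr0 // => i /andP[_ /negPf->].
    by rewrite scale0r.
  exists (fun=> 0); split=> [i|]; first by rewrite lexx ler01.
  by rewrite [X in _ + X]big1 ?addr0 // => i _; rewrite scale0r.
rewrite !sum_setT => c1; rewrite big_ord_recl unlift_none => cp.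
rewrite big_ord_recl in c1.
pose q k := c (fintype.lift ord0 k).
have q0 : \sum_k q k *: lift (fc k) = 0.
  move: cp; rewrite [X in _ + X](eq_bigr (fun k => q k *: w + q k *: lift (fc k))).
    by rewrite big_split /= -scaler_suml addrA -scalerDl c1 scale0r add0r.
  by move=> k _; rewrite liftK scalerDr.
have qH : (\row_j q (cast_ord (addn1 d) j)) *m (\matrix_j homog a (f j)) = 0.
  have := congr1 (@forget_height R d) q0; rewrite forget_height_comb.
  have -> : forget_height (0 : 'rV[R]_(d + 1 + 1)) = 0.
    by rewrite /forget_height !linear0 row_mx0.
  move=> <-; rewrite mulmx_sum_row [RHS](reindex (cast_ord (addn1 d))) /=.
    apply: eq_bigr => k _.
    by rewrite forget_height_lift rowK mxE /fc cast_ordK.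
  by apply: onW_bij; exists (cast_ord (esym (addn1 d))); [exact: cast_ordK|exact: cast_ordKV].
have qk k : c (fintype.lift ord0 k) = 0.
  move/(canRL (mulmxK fU)): qH; rewrite mul0mx => /rowP.
  by move=> /(_ (cast_ord (esym (addn1 d)) k)); rewrite !mxE cast_ordKV.
move=> j _; case: (unliftP ord0 j) => [k ->|->]; first exact: qk.
by move: c1; rewrite big1 ?addr0.
Qed.

Hypothesis h_generic : generic_height a h.

Lemma vertex_labels_regular : regular_tiling a vertex_labels.
Proof.
exists (fun i => - h i) => L; split=> [[g vg ->]|[N [upN <- _]]].
  pose N : 'rV[R]_(d + 1 + 1) :=
    row_mx (row_mx (usubmx g)^T (const_mx 1)) (dsubmx g)^T.
  have N1 : height_coord N = 1 by rewrite /height_coord row_mxKl row_mxKr mxE.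
  have Ng : normal_affine N = g.
    rewrite /normal_affine /forget_height !row_mxKl row_mxKr tr_row_mx !trmxK.
    exact: vsubmxK.
  have NL : normal_label a (fun i => - h i) N = (positives g, zeros g).
    by congr pair; apply/setP => i; rewrite !inE dot_lift Ng N1 mul1r.
  exists N; split=> //; last exact: face_projection.
  exact: vertex_upper_facet Ng.
have [N0 _] := upN.
(* Rescaling the normal to height coordinate 1 preserves signs and turns its products with the
   generators into gaps of [g]. *)
pose g := (height_coord N)^-1 *: normal_affine N.
have gE i : dot N (lift i) = height_coord N * gap g i.
  by rewrite dot_lift /gap mulrBr valueZ mulrA divff ?mul1r // gt_eqF.
have zE i : (dot N (lift i) == 0) = (i \in zeros g).
  by rewrite gE mulf_eq0 gt_eqF // inE.
(* The dimension of the facet puts a basis inside [zeros g]; genericity then excludes any further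
   zero. *)
have [|B Bz basB] := exists_basis (a := a) (S := zeros g).
  move=> u u0; apply: (upper_facet_spanning upN) => i /eqP.
  by rewrite zE => /u0.
have zg : zeros g = B.
  apply: generic_zeros => // b /(fintype.subsetP Bz).
  by rewrite inE => /eqP.
exists g; first by rewrite /vertex zg.
congr pair; apply/setP => i; last by rewrite -zE inE.
by rewrite !inE gE pmulr_rgt0.
Qed.

End Regularity.

(** An affine function vanishing at all points of a spanning configuration vanishes everywhere; its
    values at the origin and at the unit vectors show that its coefficients are zero. *)
Lemma spanning_has_basis (R : realType) (d n : nat) (a : 'I_n -> 'rV[R]_d) :
  affinely_spanning a -> exists B, is_basis a B.
Proof.
move=> span; have [|B _ basB] := exists_basis (a := a) (S := [set: 'I_n]%SET); last by exists B.
move=> g g0.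
have gy (y : 'rV[R]_d) : y *m usubmx g + dsubmx g = 0.
  have [c [c1 yc]] := span y.
  have : row_mx y (const_mx 1) *m g = 0.
    apply/colP => k; rewrite [k]ord1 [RHS]mxE.
    have -> : row_mx y (const_mx 1) = \sum_(i in [set: 'I_n]%SET) c i *: homog a i.
      by rewrite homog_comb !sum_setT yc c1.
    rewrite (value_comb a _ _ c id) big1 // => i _.
    by rewrite g0 ?mulr0 ?inE.
  rewrite -{1}[g]vsubmxK mul_row_col => <-; congr (_ + _).
  by apply/colP => k; rewrite [RHS]mxE big_ord1 [const_mx 1 _ _]mxE mul1r [k]ord1.
have d0 : dsubmx g = 0 by have := gy 0; rewrite mul0mx add0r.
rewrite -[g]vsubmxK d0 (_ : usubmx g = 0) ?col_mx0 //.
apply/row_matrixP => j; rewrite row0 rowE.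
by have := gy (delta_mx 0 j); rewrite d0 addr0.
Qed.

Theorem theorem3p3 (R : realType) (d n : nat) (d_ge1 : (1 <= d)%N)
    (a : 'I_n -> 'rV[R]_d) (a_spanning : affinely_spanning a)
    (h : 'I_n -> R) (h_generic : generic_height a h) :
  [/\ trivIset [set k | (k <= n - d - 1)%N] (level_tiles a h),
      fine_zonotopal_tiling a (produced_tiling a h) &
      regular_tiling a (produced_tiling a h)].
Proof.
rewrite produced_tiling_vertex_labels //; split.
- move=> i j _ _ [L []]; rewrite !level_tiles_vertex_labels //.
  by move=> [_ <-] [_ <-].
- exact: vertex_labels_tiling h_generic (spanning_has_basis a_spanning).
- exact: vertex_labels_regular.
Qed.
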